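(* Fix $\beta\in[0,2)$ and $h=(2-\beta)\pi^2$. For a positive integer $N_t$ put $T=\sqrt{N_t h/4}$ and define, for $z\in\mathbb{C}$, $$r_t(z) = \frac{zh}{\pi} \sum_{j=1}^{N_t} \frac{1}{\sqrt{jh}} \cdot \frac{e^{\sqrt{jh}-\sqrt{N_t h/4}}}{e^{2\sqrt{jh}-2\sqrt{N_t h/4}} + z}.$$ Assume there is a constant $K$ such that for all sufficiently large $N_t$ and all $z = r e^{\pm i\beta\pi/2}$ with $r\in[e^{4+2\beta-2T},1]$, $$\left|\int_\Gamma f(u,z)\,\delta(u)\,du\right| \le K e^{-T},$$ where $f,\delta,\Gamma$ are as in the context. Then $$|r_t(z)-\sqrt{z}\,| = \mathcal{O}\big(e^{-\sqrt{N_t h/4}}\big) = \mathcal{O}\big(e^{-\pi\sqrt{(2-\beta)N_t/4}}\big)$$ as $N_t\to\infty$, uniformly for $z\in\{re^{i\beta\pi/2}: r\in[0,1]\}\cup\{re^{-i\beta\pi/2}: r\in[0,1]\}$.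
   Context: Here $\sqrt{\cdot}$ denotes the principal branch of the square root. For $u,z\in\mathbb{C}$, $f(u,z) = \frac{z}{\pi}\,\frac{1}{\sqrt{u}}\,\frac{e^{\sqrt{u}-T}}{e^{2(\sqrt{u}-T)}+z}$. The function $\delta(u)=\mu(u)-m(u)$, where $\mu(u)=-\tfrac12$ if $\operatorname{Im}u\ge 0$ and $\mu(u)=\tfrac12$ if $\operatorname{Im}u<0$, and $m(u) = -\tfrac{i}{2}\cot(\pi u/h)$. For $z=re^{\pm i\beta\pi/2}$, the contour $\Gamma$ is the positively oriented boundary of the rectangle $\{u: 1-\beta/2\le \operatorname{Re}u\le 4T^2+1-\beta/2,\ |\operatorname{Im}u|\le a\}$ with $a = 2\pi(T+\tfrac12\log r)$. *)

(* Defs.v *)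
From Stdlib Require Import Reals.
From Coquelicot Require Import Coquelicot.
Open Scope R_scope.

Definition Cexp (z : C) : C :=
  (exp (Re z) * cos (Im z), exp (Re z) * sin (Im z)).

(* principal branch of the square root (Re >= 0; on the negative real axis
   the value is i*sqrt|z|, i.e. arg in (-pi,pi]) *)
Definition Csqrt (z : C) : C :=
  (sqrt ((Cmod z + Re z) / 2),
   if Rle_dec 0 (Im z) then sqrt ((Cmod z - Re z) / 2)
   else - sqrt ((Cmod z - Re z) / 2)).

Definition Ccos (w : C) : C := ((Cexp (Ci * w) + Cexp (- (Ci * w))) / 2)%C.
Definition Csin (w : C) : C := ((Cexp (Ci * w) - Cexp (- (Ci * w))) / (2 * Ci))%C.
Definition Ccot (w : C) : C := (Ccos w / Csin w)%C.

Definition hh (beta : R) : R := (2 - beta) * PI ^ 2.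
Definition TT (beta : R) (Nt : nat) : R := sqrt (INR Nt * hh beta / 4).

Definition f_uz (beta : R) (Nt : nat) (u z : C) : C :=
  (z / RtoC PI * / Csqrt u * Cexp (Csqrt u - RtoC (TT beta Nt))
   / (Cexp (2 * (Csqrt u - RtoC (TT beta Nt))) + z))%C.

Definition mu (u : C) : C := if Rle_dec 0 (Im u) then RtoC (-1/2) else RtoC (1/2).
Definition m_cot (beta : R) (u : C) : C :=
  (- (Ci / 2) * Ccot (RtoC PI * u / RtoC (hh beta)))%C.
Definition delta (beta : R) (u : C) : C := (mu u - m_cot beta u)%C.

Definition seg_int (g : C -> C) (p q : C) : C :=
  @RInt C_R_CompleteNormedModule
    (fun t : R => (g (p + RtoC t * (q - p)) * (q - p))%C) 0 1.

Definition rect_int (g : C -> C) (x0 x1 a : R) : C :=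
  let p1 : C := (x0, - a) in let p2 : C := (x1, - a) in
  let p3 : C := (x1, a) in let p4 : C := (x0, a) in
  (seg_int g p1 p2 + seg_int g p2 p3 + seg_int g p3 p4 + seg_int g p4 p1)%C.

(* the contour Gamma for z = r e^{+- i beta pi/2}:
   1 - beta/2 <= Re u <= 4T^2 + 1 - beta/2, |Im u| <= 2 pi (T + log r / 2) *)
Definition Gamma_int (beta : R) (Nt : nat) (r : R) (g : C -> C) : C :=
  rect_int g (1 - beta / 2) (4 * TT beta Nt ^ 2 + 1 - beta / 2)
    (2 * PI * (TT beta Nt + ln r / 2)).

Fixpoint csum (F : nat -> C) (n : nat) : C :=
  match n with O => RtoC 0 | S k => (csum F k + F (S k))%C end.

Definition r_t (beta : R) (Nt : nat) (z : C) : C :=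
  (z * RtoC (hh beta) / RtoC PI *
   csum (fun j => RtoC (/ sqrt (INR j * hh beta)) *
          (RtoC (exp (sqrt (INR j * hh beta) - sqrt (INR Nt * hh beta / 4)))
           / (RtoC (exp (2 * sqrt (INR j * hh beta) - 2 * sqrt (INR Nt * hh beta / 4))) + z)))
     Nt)%C.

Definition ray_pt (beta : R) (s : bool) (r : R) : C :=
  (RtoC r * Cexp (((0, (if s then 1 else -1) * beta * PI / 2)%R) : C))%C.

(* Main.v *)
Require Import Defs.
From Stdlib Require Import Reals Lra Lia List ZArith Classical IndefiniteDescription FinFun.
From Coquelicot Require Import Coquelicot.
Import ListNotations.
Open Scope R_scope.

(* The rational function [r_t(z)] is the quadrature sum [h * sum_j f(jh, z)] for
   the integral of [f(., z)] over the real segment from [1 - beta/2] to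
   [4 T^2 + 1 - beta/2].  Write [z = zeta^2] with [zeta = exp om].  Inside Gamma
   the function [f] has two simple poles, the squares of [T + om +- i pi/2], with
   residues [-+ i zeta / pi].  The residue theorem, applied to [f m] on the
   rectangle and to [f] on its upper and lower halves, shows that the contour
   integral of [f delta] is the integral minus the quadrature sum plus [2 pi i]
   times the sum of [delta * residue of f] at these two poles.  There [delta] is
   [O(exp (- T) / |zeta|)], because [h] is chosen such that [exp (2 pi i u / h)]
   has exactly this size.  The integral itself has the primitive
   [(2 zeta / pi) arctan (exp (sqrt u - T) / zeta)], which misses [zeta] by
   [O(exp (- T))].  For [r < exp (4 + 2 beta - 2 T)] both [r_t(z)] and [sqrt z]
   are [O(exp (- T))]. *)

(** * Complex calculus *)

(* Coquelicot's default uniform structure on [C] is that of the product [R * R],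
   while its calculus over an [AbsRing] uses the one defined by [Cmod]. *)
Notation C_topology := (AbsRing_UniformSpace C_AbsRing).

Definition Ccontinuous (g : C -> C) (p : C) : Prop :=
  continuous (T := C_topology) (U := C_topology) g p.

Definition is_Cderive (g : C -> C) (p l : C) : Prop :=
  is_derive (K := C_AbsRing) (V := AbsRing_NormedModule C_AbsRing) g p l.

Definition ex_Cderive (g : C -> C) (p : C) : Prop := exists l, is_Cderive g p l.

Lemma Cmod_minus_sym (a b : C) : Cmod (a - b) = Cmod (b - a).
Proof. rewrite <- (Cmod_opp (a - b)). f_equal. ring. Qed.

Lemma Cmod_triangle_inv (a b : C) : Cmod a - Cmod b <= Cmod (a - b).
Proof.
  pose proof (Cmod_triangle (a - b) b) as H.
  replace (a - b + b)%C with a in H by ring. lra.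
Qed.

Lemma im_le_Cmod (c : C) : Rabs (Im c) <= Cmod c.
Proof. eapply Rle_trans; [apply Rmax_r|apply Rmax_Cmod]. Qed.

Lemma re_minus (a b : C) : Re (a - b) = Re a - Re b.
Proof. reflexivity. Qed.

Lemma im_minus (a b : C) : Im (a - b) = Im a - Im b.
Proof. reflexivity. Qed.

Lemma Cmod_le_abs (a b : R) : Cmod (a, b) <= Rabs a + Rabs b.
Proof.
  replace ((a, b) : C) with (RtoC a + Ci * RtoC b)%C
    by (unfold Cplus, Cmult, Ci, RtoC; simpl; f_equal; ring).
  eapply Rle_trans; [apply Cmod_triangle|].
  rewrite Cmod_mult, Cmod_Ci, !Cmod_R. lra.
Qed.

Lemma RtoC_neq_0 (x : R) : x <> 0 -> RtoC x <> RtoC 0.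
Proof. intros H E. now apply H, RtoC_inj. Qed.

Lemma Cdiv_neq_0 (a b : C) : a <> RtoC 0 -> b <> RtoC 0 -> (a / b)%C <> RtoC 0.
Proof.
  intros Ha Hb E. apply Ha. replace a with (a / b * b)%C by (field; exact Hb). rewrite E. ring.
Qed.

Lemma Ccontinuous_eps (g : C -> C) (p : C) :
  Ccontinuous g p <->
  forall eps, 0 < eps -> exists d, 0 < d /\
    forall u, Cmod (u - p) < d -> Cmod (g u - g p) < eps.
Proof.
  unfold Ccontinuous, continuous. rewrite filterlim_locally. split.
  - intros H eps He. destruct (H (mkposreal _ He)) as [d Hd].
    exists d. split; [apply cond_pos|exact Hd].
  - intros H [eps He]. destruct (H eps He) as [d [Hd Hu]].
    now exists (mkposreal _ Hd).
Qed.

Lemma is_Cderive_eps (g : C -> C) (p l : C) :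
  is_Cderive g p l <->
  forall eps, 0 < eps -> exists d, 0 < d /\ forall u, Cmod (u - p) < d ->
    Cmod (g u - g p - (u - p) * l) <= eps * Cmod (u - p).
Proof.
  split.
  - intros [_ H] eps He.
    destruct (H p (fun P HP => HP) (mkposreal _ He)) as [d Hd].
    exists d. split; [apply cond_pos|exact Hd].
  - intros H. split; [apply is_linear_scal_l|]. intros x Hx.
    apply (is_filter_lim_locally_unique (V := AbsRing_NormedModule C_AbsRing)) in Hx.
    subst x. intros [eps He]. destruct (H eps He) as [d [Hd Hu]].
    now exists (mkposreal _ Hd).
Qed.

Lemma Ccontinuous_const (c p : C) : Ccontinuous (fun _ => c) p.
Proof. exact (continuous_const (U := C_topology) (V := C_topology) c p). Qed.

Lemma Ccontinuous_plus (g k : C -> C) (p : C) :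
  Ccontinuous g p -> Ccontinuous k p -> Ccontinuous (fun u => g u + k u)%C p.
Proof. apply (continuous_plus (U := C_topology) (V := AbsRing_NormedModule C_AbsRing)). Qed.

Lemma Ccontinuous_mult (g k : C -> C) (p : C) :
  Ccontinuous g p -> Ccontinuous k p -> Ccontinuous (fun u => g u * k u)%C p.
Proof. apply (continuous_mult (U := C_topology) (K := C_AbsRing)). Qed.

Lemma is_Cderive_continuous (g : C -> C) (p l : C) :
  is_Cderive g p l -> Ccontinuous g p.
Proof.
  intros H. apply (ex_derive_continuous (V := AbsRing_NormedModule C_AbsRing)).
  now exists l.
Qed.

Lemma ex_Cderive_continuous (g : C -> C) (p : C) : ex_Cderive g p -> Ccontinuous g p.
Proof. intros [l H]. exact (is_Cderive_continuous g p l H). Qed.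

Lemma is_Cderive_eq (g : C -> C) (p a b : C) :
  is_Cderive g p a -> a = b -> is_Cderive g p b.
Proof. now intros H <-. Qed.

Lemma is_Cderive_ext (g k : C -> C) (p l : C) :
  (forall u, g u = k u) -> is_Cderive g p l -> is_Cderive k p l.
Proof. intros H. now apply (is_derive_ext (V := AbsRing_NormedModule C_AbsRing)). Qed.

Lemma is_Cderive_const (c p : C) : is_Cderive (fun _ => c) p 0.
Proof. apply (is_derive_const (V := AbsRing_NormedModule C_AbsRing)). Qed.

Lemma is_Cderive_id (p : C) : is_Cderive (fun u => u) p 1.
Proof. exact (is_derive_id (K := C_AbsRing) p). Qed.

Lemma is_Cderive_plus (g k : C -> C) (p a b : C) :
  is_Cderive g p a -> is_Cderive k p b -> is_Cderive (fun u => g u + k u)%C p (a + b).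
Proof. apply (is_derive_plus (V := AbsRing_NormedModule C_AbsRing)). Qed.

Lemma is_Cderive_minus (g k : C -> C) (p a b : C) :
  is_Cderive g p a -> is_Cderive k p b -> is_Cderive (fun u => g u - k u)%C p (a - b).
Proof. apply (is_derive_minus (V := AbsRing_NormedModule C_AbsRing)). Qed.

Lemma is_Cderive_mult (g k : C -> C) (p a b : C) :
  is_Cderive g p a -> is_Cderive k p b ->
  is_Cderive (fun u => g u * k u)%C p (a * k p + g p * b).
Proof.
  intros Hg Hk. apply (is_derive_mult (K := C_AbsRing) g k); auto. exact Cmult_comm.
Qed.

Lemma is_Cderive_comp (g k : C -> C) (p a b : C) :
  is_Cderive g (k p) a -> is_Cderive k p b -> is_Cderive (fun u => g (k u)) p (a * b).
Proof.
  rewrite Cmult_comm. apply (is_derive_comp (V := AbsRing_NormedModule C_AbsRing)).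
Qed.

Lemma is_Cderive_scal (c : C) (g : C -> C) (p l : C) :
  is_Cderive g p l -> is_Cderive (fun u => c * g u)%C p (c * l).
Proof.
  intros H. eapply is_Cderive_eq.
  - exact (is_Cderive_mult _ g p _ _ (is_Cderive_const c p) H).
  - cbv beta. ring.
Qed.

Lemma is_Cderive_inv (p : C) : p <> RtoC 0 -> is_Cderive (fun u => / u)%C p (- / (p * p)).
Proof.
  intros Hp. pose proof (proj1 (Cmod_gt_0 p) Hp) as Hm. set (m := Cmod p) in *.
  apply is_Cderive_eps. intros eps He.
  exists (Rmin (m / 2) (eps * (m * m * m / 2))). split.
  { apply Rmin_glb_lt; [lra|]. repeat apply Rmult_lt_0_compat; lra. }
  intros u Hu. set (e := Cmod (u - p)) in *.
  pose proof (Rlt_le_trans _ _ _ Hu (Rmin_l _ _)) as Hu_half.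
  pose proof (Rlt_le_trans _ _ _ Hu (Rmin_r _ _)) as Hu_eps.
  assert (Hmu : m / 2 < Cmod u).
  { pose proof (Cmod_triangle_inv p u) as H. rewrite Cmod_minus_sym in H.
    fold m e in H. lra. }
  assert (Hu0 : u <> RtoC 0) by (apply Cmod_gt_0; lra).
  replace (/ u - / p - (u - p) * - / (p * p))%C
    with ((u - p) * (u - p) / (u * (p * p)))%C by (field; auto).
  rewrite Cmod_div, !Cmod_mult by (repeat apply Cmult_neq_0; auto). fold m e.
  assert (He0 : 0 <= e) by apply Cmod_ge_0.
  assert (Hmm : 0 < m * m) by nra.
  apply Rle_div_l; [nra|].
  apply Rle_trans with (e * (eps * (m * m * m / 2))); [apply Rmult_le_compat_l; lra|].
  rewrite (Rmult_comm eps e), (Rmult_assoc e). apply Rmult_le_compat_l; [exact He0|].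
  apply Rmult_le_compat_l; nra.
Qed.

Lemma is_Cderive_inverse (f g : C -> C) (p l : C) (d : R) : 0 < d ->
  (forall u, Cmod (u - p) < d -> f (g u) = u) ->
  Ccontinuous g p -> is_Cderive f (g p) l -> l <> RtoC 0 -> is_Cderive g p (/ l).
Proof.
  intros Hd Hfg Hg Hf Hl. pose proof (proj1 (Cmod_gt_0 l) Hl) as Hm.
  set (m := Cmod l) in *. apply is_Cderive_eps. intros eps He.
  set (eta := Rmin (m / 2) (eps * (m * m / 2))).
  assert (Heta : 0 < eta) by (apply Rmin_glb_lt; [lra|repeat apply Rmult_lt_0_compat; lra]).
  assert (Heta_m : eta <= m / 2) by apply Rmin_l.
  assert (Heta_eps : eta <= eps * (m * m / 2)) by apply Rmin_r.
  destruct (proj1 (is_Cderive_eps f (g p) l) Hf eta Heta) as [df [Hdf Hfexp]].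
  destruct (proj1 (Ccontinuous_eps g p) Hg df Hdf) as [dg [Hdg Hgclose]].
  exists (Rmin d dg). split; [now apply Rmin_glb_lt|]. intros u Hu.
  specialize (Hfexp _ (Hgclose u (Rlt_le_trans _ _ _ Hu (Rmin_r _ _)))).
  rewrite (Hfg u) in Hfexp by exact (Rlt_le_trans _ _ _ Hu (Rmin_l _ _)).
  rewrite (Hfg p) in Hfexp by (replace (p - p)%C with (RtoC 0) by ring; now rewrite Cmod_0).
  set (D := (g u - g p)%C) in *.
  assert (HD : Cmod D * m <= Cmod (u - p) + eta * Cmod D).
  { unfold m. rewrite <- Cmod_mult.
    pose proof (Cmod_triangle_inv (D * l) (u - p)) as H.
    rewrite (Cmod_minus_sym (D * l)) in H. lra. }
  pose proof (Cmod_ge_0 D). pose proof (Cmod_ge_0 (u - p)).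
  replace (D - (u - p) * / l)%C with (- ((u - p - D * l) / l))%C by (field; exact Hl).
  rewrite Cmod_opp, Cmod_div by exact Hl. fold m.
  apply Rle_div_l; [exact Hm|].
  eapply Rle_trans; [exact Hfexp|].
  apply Rle_trans with (eps * m * (Cmod D * m / 2)).
  - replace (eps * m * (Cmod D * m / 2)) with (eps * (m * m / 2) * Cmod D) by field.
    apply Rmult_le_compat_r; lra.
  - replace (eps * Cmod (u - p) * m) with (eps * m * Cmod (u - p)) by ring.
    apply Rmult_le_compat_l; nra.
Qed.

Lemma ex_Cderive_const (c p : C) : ex_Cderive (fun _ => c) p.
Proof. eexists. apply is_Cderive_const. Qed.

Lemma ex_Cderive_plus (g k : C -> C) (p : C) :
  ex_Cderive g p -> ex_Cderive k p -> ex_Cderive (fun u => g u + k u)%C p.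
Proof. intros [a Ha] [b Hb]. eexists. apply is_Cderive_plus; eassumption. Qed.

Lemma ex_Cderive_mult (g k : C -> C) (p : C) :
  ex_Cderive g p -> ex_Cderive k p -> ex_Cderive (fun u => g u * k u)%C p.
Proof. intros [a Ha] [b Hb]. eexists. apply is_Cderive_mult; eassumption. Qed.

Lemma ex_Cderive_comp (g k : C -> C) (p : C) :
  ex_Cderive g (k p) -> ex_Cderive k p -> ex_Cderive (fun u => g (k u)) p.
Proof. intros [a Ha] [b Hb]. eexists. apply is_Cderive_comp; eassumption. Qed.

Lemma ex_Cderive_div (g k : C -> C) (p : C) :
  ex_Cderive g p -> ex_Cderive k p -> k p <> RtoC 0 -> ex_Cderive (fun u => g u / k u)%C p.
Proof.
  intros Hg Hk Hk_neq_0. apply ex_Cderive_mult; [exact Hg|].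
  apply (ex_Cderive_comp Cinv); [|exact Hk]. eexists. now apply is_Cderive_inv.
Qed.

(** * The exponential, the square root and the logarithm *)

Lemma exp_le (x y : R) : x <= y -> exp x <= exp y.
Proof.
  intros [H| ->]; [left; now apply exp_increasing|apply Rle_refl].
Qed.

Lemma Cexp_plus (a b : C) : Cexp (a + b) = (Cexp a * Cexp b)%C.
Proof.
  destruct a as [a1 a2], b as [b1 b2]. unfold Cexp, Cmult, Cplus; simpl.
  rewrite exp_plus, cos_plus, sin_plus. f_equal; ring.
Qed.

Lemma Cexp_RtoC (x : R) : Cexp (RtoC x) = RtoC (exp x).
Proof. unfold Cexp, RtoC; simpl. rewrite cos_0, sin_0. f_equal; ring. Qed.

Lemma Cexp_0 : Cexp 0 = RtoC 1.
Proof. rewrite Cexp_RtoC. now rewrite exp_0. Qed.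

Lemma Cmod_Cexp (a : C) : Cmod (Cexp a) = exp (Re a).
Proof.
  rewrite <- (sqrt_Rsqr (exp (Re a))) by (left; apply exp_pos).
  unfold Cmod, Cexp; simpl. f_equal.
  transitivity (Rsqr (exp (Re a)) * (Rsqr (sin (Im a)) + Rsqr (cos (Im a)))).
  - unfold Rsqr. ring.
  - rewrite sin2_cos2. ring.
Qed.

Lemma Cexp_neq_0 (a : C) : Cexp a <> RtoC 0.
Proof. apply Cmod_gt_0. rewrite Cmod_Cexp. apply exp_pos. Qed.

Lemma derivable_pt_lim_remainder (f : R -> R) (x l : R) : derivable_pt_lim f x l ->
  forall eps, 0 < eps -> exists d, 0 < d /\ forall h, Rabs h < d ->
    Rabs (f (x + h) - f x - l * h) <= eps * Rabs h.
Proof.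
  intros Hf eps He. destruct (Hf eps He) as [d Hd]. exists d. split; [apply cond_pos|].
  intros h Hh. destruct (Req_dec h 0) as [->|Hh0].
  - rewrite Rplus_0_r, Rmult_0_r, !Rminus_diag, Rabs_R0. lra.
  - replace (f (x + h) - f x - l * h) with (((f (x + h) - f x) / h - l) * h) by (now field).
    rewrite Rabs_mult. apply Rmult_le_compat_r; [apply Rabs_pos|]. left. now apply Hd.
Qed.

Lemma Cexp_expansion_bound (a b e : R) : e <= 1 / 4 -> Rabs a <= e ->
  Rabs (exp a - 1 - a) <= e * Rabs a -> Rabs (cos b - 1) <= e * Rabs b ->
  Rabs (sin b - b) <= e * Rabs b ->
  Cmod (Cexp (a, b) - 1 - (a, b)) <= 8 * e * Cmod (a, b).
Proof.
  intros He Hae Hexp Hcos Hsin.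
  replace (Cexp (a, b) - 1 - (a, b))%C
    with (RtoC (exp a) * ((cos b - 1)%R, (sin b - b)%R)
          + RtoC (exp a - 1) * (Ci * RtoC b) + RtoC (exp a - 1 - a))%C
    by (unfold Cexp, Cminus, Cmult, Cplus, Copp, Ci, RtoC; simpl; f_equal; ring).
  pose proof (re_le_Cmod (a, b)) as Ha. pose proof (im_le_Cmod (a, b)) as Hb. simpl in Ha, Hb.
  assert (Hexp1 : Rabs (exp a - 1) <= 2 * e).
  { replace (exp a - 1) with ((exp a - 1 - a) + a) by ring.
    eapply Rle_trans; [apply Rabs_triang|]. pose proof (Rabs_pos a). nra. }
  assert (Hexp2 : Rabs (exp a) <= 2).
  { replace (exp a) with ((exp a - 1) + 1) by ring.
    eapply Rle_trans; [apply Rabs_triang|]. rewrite Rabs_R1. lra. }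
  eapply Rle_trans; [apply Cmod_triangle|].
  eapply Rle_trans; [apply Rplus_le_compat_r, Cmod_triangle|].
  rewrite !Cmod_mult, Cmod_Ci, !Cmod_R.
  pose proof (Cmod_le_abs (cos b - 1) (sin b - b)) as Hcs.
  pose proof (Rabs_pos a). pose proof (Rabs_pos b). pose proof (Rabs_pos (exp a)).
  pose proof (Rabs_pos (exp a - 1)). pose proof (Cmod_ge_0 (cos b - 1, sin b - b)).
  assert (Rabs (exp a) * Cmod (cos b - 1, sin b - b) <= 2 * (2 * (e * Rabs b)))
    by (apply Rmult_le_compat; lra).
  assert (Rabs (exp a - 1) * (1 * Rabs b) <= 2 * e * (1 * Rabs b))
    by (apply Rmult_le_compat_r; lra).
  assert (e * Rabs a <= e * Cmod (a, b)) by (apply Rmult_le_compat_l; lra).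
  assert (e * Rabs b <= e * Cmod (a, b)) by (apply Rmult_le_compat_l; lra).
  lra.
Qed.

Lemma is_Cderive_Cexp_0 : is_Cderive Cexp 0 1.
Proof.
  apply is_Cderive_eps. intros eps Heps.
  set (e := Rmin (1 / 4) (eps / 8)).
  assert (He0 : 0 < e) by (apply Rmin_glb_lt; lra).
  destruct (derivable_pt_lim_remainder exp 0 1) with e as [d1 [Hd1 Hexp]]; auto.
  { rewrite <- exp_0. apply derivable_pt_lim_exp. }
  destruct (derivable_pt_lim_remainder cos 0 0) with e as [d2 [Hd2 Hcos]]; auto.
  { replace 0 with (- sin 0) at 2 by (rewrite sin_0; ring). apply derivable_pt_lim_cos. }
  destruct (derivable_pt_lim_remainder sin 0 1) with e as [d3 [Hd3 Hsin]]; auto.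
  { rewrite <- cos_0. apply derivable_pt_lim_sin. }
  exists (Rmin (Rmin d1 d2) (Rmin d3 e)). split; [apply Rmin_glb_lt; now apply Rmin_glb_lt|].
  intros [a b]. rewrite Cexp_0.
  set (u := (a, b) : C). replace (u - 0)%C with u by ring. rewrite Cmult_1_r. intros Hu.
  pose proof (re_le_Cmod u) as Ha. pose proof (im_le_Cmod u) as Hb. simpl in Ha, Hb.
  pose proof (Rmin_l (Rmin d1 d2) (Rmin d3 e)). pose proof (Rmin_r (Rmin d1 d2) (Rmin d3 e)).
  pose proof (Rmin_l d1 d2). pose proof (Rmin_r d1 d2).
  pose proof (Rmin_l d3 e). pose proof (Rmin_r d3 e).
  specialize (Hexp a ltac:(lra)). specialize (Hcos b ltac:(lra)). specialize (Hsin b ltac:(lra)).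
  rewrite Rplus_0_l in Hexp, Hcos, Hsin.
  rewrite exp_0, Rmult_1_l in Hexp. rewrite cos_0, Rmult_0_l, Rminus_0_r in Hcos.
  rewrite sin_0, Rminus_0_r, Rmult_1_l in Hsin.
  eapply Rle_trans.
  - apply (Cexp_expansion_bound a b e); auto; [apply Rmin_l|lra].
  - apply Rmult_le_compat_r; [apply Cmod_ge_0|]. pose proof (Rmin_r (1 / 4) (eps / 8)).
    unfold e. lra.
Qed.

Lemma is_Cderive_Cexp (p : C) : is_Cderive Cexp p (Cexp p).
Proof.
  apply is_Cderive_ext with (fun u => Cexp p * Cexp (u - p))%C.
  - intros u. rewrite <- Cexp_plus. f_equal. ring.
  - eapply is_Cderive_eq.
    + apply is_Cderive_scal, is_Cderive_comp.
      * replace (p - p)%C with (RtoC 0) by ring. apply is_Cderive_Cexp_0.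
      * apply is_Cderive_minus; [apply is_Cderive_id|apply is_Cderive_const].
    + ring.
Qed.

Lemma Csqrt_sqr (s : C) : 0 < Re s -> Csqrt (s * s) = s.
Proof.
  destruct s as [p q]. simpl. intros Hp. unfold Csqrt.
  assert (E : Cmod ((p, q) * (p, q)) = p * p + q * q).
  { rewrite Cmod_mult. unfold Cmod; simpl. rewrite sqrt_sqrt; nra. }
  rewrite E. unfold Cmult; simpl.
  replace ((p * p + q * q + (p * p - q * q)) / 2) with (p * p) by field.
  replace ((p * p + q * q - (p * p - q * q)) / 2) with (q * q) by field.
  rewrite sqrt_square by lra. f_equal.
  destruct (Rle_dec 0 (p * q + q * p)).
  - apply sqrt_square. nra.
  - replace (q * q) with ((- q) * (- q)) by ring. rewrite sqrt_square by nra. ring.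
Qed.

Lemma Csqrt_RtoC (x : R) : 0 <= x -> Csqrt (RtoC x) = RtoC (sqrt x).
Proof.
  intros Hx. unfold Csqrt. rewrite Cmod_R, Rabs_pos_eq by exact Hx. simpl.
  replace ((x + x) / 2) with x by field. replace ((x - x) / 2) with 0 by field.
  rewrite sqrt_0. unfold RtoC. f_equal. destruct (Rle_dec 0 0); lra.
Qed.

Lemma Re_Csqrt_pos (u : C) : 0 < Re u -> 0 < Re (Csqrt u).
Proof.
  intros Hu. apply sqrt_lt_R0. pose proof (Cmod_ge_0 u). lra.
Qed.

Lemma Csqrt_neq_0 (u : C) : 0 < Re u -> Csqrt u <> RtoC 0.
Proof.
  intros Hu E. apply Re_Csqrt_pos in Hu. rewrite E in Hu. simpl in Hu. lra.
Qed.

Lemma Csqrt_mult_self (u : C) : 0 < Re u -> (Csqrt u * Csqrt u)%C = u.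
Proof.
  intros Hu. pose proof (re_le_Cmod u) as Hm. rewrite Rabs_pos_eq in Hm by lra.
  set (A := (Cmod u + Re u) / 2). set (B := (Cmod u - Re u) / 2).
  assert (HA : sqrt A * sqrt A = A) by (apply sqrt_sqrt; unfold A; lra).
  assert (HB : sqrt B * sqrt B = B) by (apply sqrt_sqrt; unfold B; lra).
  assert (HAB : 2 * (sqrt A * sqrt B) = Rabs (Im u)).
  { rewrite <- sqrt_mult by (unfold A, B; lra).
    replace (A * B) with (Rsqr (Im u / 2)).
    - rewrite sqrt_Rsqr_abs. unfold Rdiv.
      rewrite Rabs_mult, (Rabs_pos_eq (/ 2)) by lra. field.
    - unfold A, B, Rsqr. pose proof (Cmod2_alt u). nra. }
  assert (HRe : A - B = Re u) by (unfold A, B; field).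
  unfold Csqrt. fold A B. destruct u as [x y]. unfold Cmult; simpl in *.
  destruct (Rle_dec 0 y).
  - rewrite Rabs_pos_eq in HAB by lra. f_equal; lra.
  - rewrite Rabs_left in HAB by lra. f_equal; nra.
Qed.

Lemma Re_pos_near (u p : C) : Cmod (u - p) < Re p -> 0 < Re u.
Proof.
  intros H. pose proof (re_le_Cmod (u - p)) as Hre.
  rewrite re_minus in Hre. apply Rabs_le_between in Hre. lra.
Qed.

(* [u - p] is [sqrt u - sqrt p] times [sqrt u + sqrt p], and the real part of
   the latter factor is at least that of [sqrt p]. *)
Lemma Csqrt_continuous (p : C) : 0 < Re p -> Ccontinuous Csqrt p.
Proof.
  intros Hp. pose proof (Re_Csqrt_pos p Hp) as Hs.
  apply Ccontinuous_eps. intros eps He.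
  exists (Rmin (Re p) (eps * Re (Csqrt p))). split; [apply Rmin_glb_lt; nra|].
  intros u Hu.
  assert (Hu0 : 0 < Re u) by (apply (Re_pos_near u p), (Rlt_le_trans _ _ _ Hu), Rmin_l).
  assert (Hsum : Re (Csqrt p) <= Cmod (Csqrt u + Csqrt p)).
  { pose proof (Re_Csqrt_pos u Hu0).
    eapply Rle_trans; [|apply re_le_Cmod]. eapply Rle_trans; [|apply Rle_abs].
    simpl in *. lra. }
  assert (Hprod : Cmod (u - p) = Cmod (Csqrt u - Csqrt p) * Cmod (Csqrt u + Csqrt p)).
  { rewrite <- Cmod_mult. f_equal.
    transitivity (Csqrt u * Csqrt u - Csqrt p * Csqrt p)%C.
    - now rewrite !Csqrt_mult_self.
    - ring. }
  pose proof (Rlt_le_trans _ _ _ Hu (Rmin_r _ _)) as Hu1.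
  pose proof (Cmod_ge_0 (Csqrt u - Csqrt p)). nra.
Qed.

Lemma is_Cderive_Csqrt (p : C) : 0 < Re p -> is_Cderive Csqrt p (/ (2 * Csqrt p)).
Proof.
  intros Hp. apply is_Cderive_inverse with (f := fun u => (u * u)%C) (d := Re p).
  - exact Hp.
  - intros u Hu. now apply Csqrt_mult_self, (Re_pos_near u p).
  - now apply Csqrt_continuous.
  - eapply is_Cderive_eq; [apply is_Cderive_mult; apply is_Cderive_id|cbv beta; ring].
  - apply Cmult_neq_0; [apply RtoC_neq_0; lra|now apply Csqrt_neq_0].
Qed.

(* The principal logarithm on the right half plane; elsewhere the formula is wrong. *)
Definition Clog (u : C) : C := (ln (Cmod u), atan (Im u / Re u)).

Lemma Cexp_Clog (u : C) : 0 < Re u -> Cexp (Clog u) = u.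
Proof.
  intros Hu. pose proof (re_le_Cmod u) as Hm. rewrite Rabs_pos_eq in Hm by lra.
  unfold Cexp, Clog; simpl. rewrite exp_ln by lra. rewrite cos_atan, sin_atan.
  assert (E : sqrt (1 + (Im u / Re u)²) = Cmod u / Re u).
  { rewrite <- (sqrt_Rsqr (Cmod u / Re u)) by (apply Rdiv_le_0_compat; lra).
    f_equal. unfold Rsqr.
    transitivity ((Re u ^ 2 + Im u ^ 2) / Re u ^ 2); [field; lra|].
    rewrite <- Cmod2_alt. field. lra. }
  rewrite E. destruct u as [x y]; simpl in *. f_equal; field; lra.
Qed.

Lemma Cmod_continuous (p : C) : continuous (T := C_topology) Cmod p.
Proof. apply (filterlim_norm (V := AbsRing_NormedModule C_AbsRing) p). Qed.

Lemma Re_continuous (p : C) : continuous (T := C_topology) Re p.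
Proof.
  apply filterlim_locally. intros eps. exists eps. intros u Hu.
  exact (Rle_lt_trans _ _ _ (re_le_Cmod (u - p)) Hu).
Qed.

Lemma Im_continuous (p : C) : continuous (T := C_topology) Im p.
Proof.
  apply filterlim_locally. intros eps. exists eps. intros u Hu.
  exact (Rle_lt_trans _ _ _ (im_le_Cmod (u - p)) Hu).
Qed.

Lemma Ccontinuous_pair (g k : C -> R) (p : C) :
  continuous (T := C_topology) g p -> continuous (T := C_topology) k p ->
  Ccontinuous (fun u => (g u, k u)) p.
Proof.
  intros Hg Hk. apply filterlim_locally. intros eps.
  pose proof (proj1 (filterlim_locally _ _) Hg (pos_div_2 eps)) as Hgclose.
  pose proof (proj1 (filterlim_locally _ _) Hk (pos_div_2 eps)) as Hkclose.
  generalize (filter_and _ _ Hgclose Hkclose). apply filter_imp. intros u [Hug Huk].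
  change (Cmod (g u - g p, k u - k p) < eps).
  eapply Rle_lt_trans; [apply Cmod_le_abs|].
  change (Rabs (g u - g p) < eps / 2) in Hug. change (Rabs (k u - k p) < eps / 2) in Huk. lra.
Qed.

Lemma Clog_continuous (p : C) : 0 < Re p -> Ccontinuous Clog p.
Proof.
  intros Hp. pose proof (re_le_Cmod p) as Hm. rewrite Rabs_pos_eq in Hm by lra.
  apply Ccontinuous_pair.
  - apply (continuous_comp (U := C_topology) Cmod ln); [apply Cmod_continuous|].
    apply continuous_ln. lra.
  - apply (continuous_comp (U := C_topology) (fun u => Im u / Re u) atan); [|apply continuous_atan].
    apply (continuous_mult (U := C_topology) (K := R_AbsRing)); [apply Im_continuous|].
    apply (continuous_comp (U := C_topology) Re Rinv); [apply Re_continuous|].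
    apply continuous_Rinv. lra.
Qed.

Lemma is_Cderive_Clog (p : C) : 0 < Re p -> is_Cderive Clog p (/ p).
Proof.
  intros Hp. apply is_Cderive_inverse with (f := Cexp) (d := Re p).
  - exact Hp.
  - intros u Hu. now apply Cexp_Clog, (Re_pos_near u p).
  - now apply Clog_continuous.
  - rewrite <- (Cexp_Clog p) at 2 by exact Hp. apply is_Cderive_Cexp.
  - intros ->. simpl in Hp. lra.
Qed.

Lemma Clog_rotate (u : C) : 0 < Re u -> 0 < Im u ->
  Clog u = (Clog (- Ci * u) + RtoC (PI / 2) * Ci)%C.
Proof.
  destruct u as [x y]. simpl. intros Hx Hy.
  assert (E : (- Ci * (x, y))%C = (y, - x))
    by (unfold Cmult, Copp, Ci; simpl; f_equal; ring).
  assert (Hyx : atan (y / x) = PI / 2 - atan (x / y)).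
  { rewrite <- atan_inv by (now apply Rdiv_lt_0_compat). f_equal. field. lra. }
  assert (Hm : Cmod (y, - x) = Cmod (x, y))
    by (rewrite <- E, Cmod_mult, Cmod_opp, Cmod_Ci; ring).
  rewrite E. unfold Clog. rewrite Hm. simpl.
  unfold Cplus, Cmult, Ci, RtoC; simpl. f_equal; [ring|].
  replace (- x / y) with (- (x / y)) by (field; lra). rewrite Hyx, atan_opp. ring.
Qed.

(** * Integrals along segments *)

Definition seg_point (p q : C) (t : R) : C := (p + RtoC t * (q - p))%C.

Definition is_seg_int (g : C -> C) (p q I : C) : Prop :=
  is_RInt (V := C_R_NormedModule) (fun t => g (seg_point p q t) * (q - p))%C 0 1 I.

Definition ex_seg_int (g : C -> C) (p q : C) : Prop := exists I, is_seg_int g p q I.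

Lemma is_seg_int_unique (g : C -> C) (p q I : C) : is_seg_int g p q I -> seg_int g p q = I.
Proof. apply (is_RInt_unique (V := C_R_CompleteNormedModule)). Qed.

Lemma seg_int_correct (g : C -> C) (p q : C) :
  ex_seg_int g p q -> is_seg_int g p q (seg_int g p q).
Proof. intros [I HI]. now rewrite (is_seg_int_unique g p q I HI). Qed.

Lemma norm_C_R (x : C) : norm (V := C_R_NormedModule) x = Cmod x.
Proof.
  unfold norm; simpl. unfold prod_norm, norm; simpl. unfold Cmod, abs; simpl.
  f_equal. pose proof (pow2_abs (fst x)). pose proof (pow2_abs (snd x)). simpl in *. lra.
Qed.

Lemma scal_C_R (r : R) (x : C) : scal (V := C_R_NormedModule) r x = (RtoC r * x)%C.
Proof.
  destruct x as [a b]. unfold scal; simpl. unfold prod_scal, scal; simpl.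
  unfold mult, Cmult, RtoC; simpl. f_equal; ring.
Qed.

Lemma is_RInt_Cmult (c : C) (g : R -> C) (a b : R) (I : C) :
  is_RInt (V := C_R_NormedModule) g a b I ->
  is_RInt (V := C_R_NormedModule) (fun t => c * g t)%C a b (c * I)%C.
Proof.
  intros H. destruct c as [c1 c2].
  pose proof (is_RInt_fct_extend_fst _ _ _ _ H) as Hre.
  pose proof (is_RInt_fct_extend_snd _ _ _ _ H) as Him.
  apply (is_RInt_fct_extend_pair (U := R_NormedModule) (V := R_NormedModule)).
  - apply (is_RInt_minus (V := R_NormedModule) (fun t => c1 * fst (g t)));
      now apply (is_RInt_scal (V := R_NormedModule)).
  - apply (is_RInt_plus (V := R_NormedModule) (fun t => c1 * snd (g t)));
      now apply (is_RInt_scal (V := R_NormedModule)).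
Qed.

Lemma is_RInt_C_ext (f g : R -> C) (a b : R) (I : C) : a <= b ->
  (forall t, a < t < b -> f t = g t) ->
  is_RInt (V := C_R_NormedModule) f a b I -> is_RInt (V := C_R_NormedModule) g a b I.
Proof.
  intros Hab H. apply (is_RInt_ext (V := C_R_NormedModule)).
  now rewrite Rmin_left, Rmax_right by exact Hab.
Qed.

Lemma is_RInt_C_comp_lin (f : R -> C) (u v a b : R) (I : C) : a <= b ->
  is_RInt (V := C_R_NormedModule) f (u * a + v) (u * b + v) I ->
  is_RInt (V := C_R_NormedModule) (fun t => (RtoC u * f (u * t + v)%R)%C) a b I.
Proof.
  intros Hab H. apply (is_RInt_comp_lin (V := C_R_NormedModule)) in H. revert H.
  apply is_RInt_C_ext; [exact Hab|]. intros t _. apply scal_C_R.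
Qed.

Lemma is_seg_int_ext (g k : C -> C) (p q I : C) :
  (forall t, 0 < t < 1 -> g (seg_point p q t) = k (seg_point p q t)) ->
  is_seg_int g p q I -> is_seg_int k p q I.
Proof. intros H. apply is_RInt_C_ext; [lra|]. intros t Ht. now rewrite H. Qed.

Lemma is_seg_int_plus (g k : C -> C) (p q I J : C) :
  is_seg_int g p q I -> is_seg_int k p q J -> is_seg_int (fun u => g u + k u)%C p q (I + J)%C.
Proof.
  intros Hg Hk. eapply is_RInt_C_ext; [lra| |].
  2: exact (is_RInt_plus (V := C_R_NormedModule) _ _ _ _ _ _ Hg Hk).
  intros t _. symmetry. apply Cmult_plus_distr_r.
Qed.

Lemma is_seg_int_scal (c : C) (g : C -> C) (p q I : C) :
  is_seg_int g p q I -> is_seg_int (fun u => c * g u)%C p q (c * I)%C.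
Proof.
  intros Hg. eapply is_RInt_C_ext; [lra| |exact (is_RInt_Cmult c _ _ _ _ Hg)].
  intros t _. apply Cmult_assoc.
Qed.

Lemma is_seg_int_reverse (g : C -> C) (p q I : C) :
  is_seg_int g p q I -> is_seg_int g q p (- I)%C.
Proof.
  intros Hg. apply (is_RInt_swap (V := C_R_NormedModule)) in Hg.
  replace 1 with (- (1) * 0 + 1) in Hg at 1 by ring.
  replace 0 with (- (1) * 1 + 1) in Hg at 2 by ring.
  apply is_RInt_C_comp_lin in Hg; [|lra]. revert Hg.
  apply is_RInt_C_ext; [lra|]. intros t _.
  replace (seg_point p q (- (1) * t + 1)) with (seg_point q p t).
  - rewrite RtoC_opp. ring.
  - unfold seg_point. rewrite RtoC_plus, RtoC_mult, RtoC_opp. ring.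
Qed.

Lemma is_seg_int_Chasles (g : C -> C) (p q I J : C) (s : R) : 0 < s < 1 ->
  is_seg_int g p (seg_point p q s) I -> is_seg_int g (seg_point p q s) q J ->
  is_seg_int g p q (I + J)%C.
Proof.
  unfold is_seg_int. intros Hs HI HJ.
  assert (Hs0 : RtoC s <> RtoC 0) by (apply RtoC_neq_0; lra).
  assert (Hs1 : (RtoC 1 - RtoC s)%C <> RtoC 0)
    by (rewrite <- RtoC_minus; apply RtoC_neq_0; lra).
  apply (is_RInt_Chasles (V := C_R_NormedModule)) with s.
  - replace 0 with (/ s * 0 + 0) in HI by ring.
    replace 1 with (/ s * s + 0) in HI by (field; lra).
    apply is_RInt_C_comp_lin in HI; [|lra]. revert HI.
    apply is_RInt_C_ext; [lra|]. intros t _.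
    replace (seg_point p (seg_point p q s) (/ s * t + 0)) with (seg_point p q t);
      unfold seg_point; rewrite ?RtoC_plus, ?RtoC_mult, RtoC_inv by lra; field; exact Hs0.
  - set (c := / (1 - s)) in *.
    replace 0 with (c * s + - (c * s)) in HJ by ring.
    replace 1 with (c * 1 + - (c * s)) in HJ by (unfold c; field; lra).
    apply is_RInt_C_comp_lin in HJ; [|lra]. revert HJ.
    apply is_RInt_C_ext; [lra|]. intros t _.
    replace (seg_point (seg_point p q s) q (c * t + - (c * s))) with (seg_point p q t);
      unfold seg_point, c; rewrite ?RtoC_plus, ?RtoC_opp, ?RtoC_mult, RtoC_inv, RtoC_minus by lra;
      field; exact Hs1.
Qed.

Lemma is_seg_int_bound (g : C -> C) (p q I : C) (M : R) :
  (forall t, 0 <= t <= 1 -> Cmod (g (seg_point p q t)) <= M) ->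
  is_seg_int g p q I -> Cmod I <= Cmod (q - p) * M.
Proof.
  intros HM HI. rewrite <- norm_C_R.
  replace (Cmod (q - p) * M) with ((1 - 0) * (M * Cmod (q - p))) by ring.
  eapply (norm_RInt_le_const (V := C_R_NormedModule)); [lra| |exact HI].
  intros t Ht. rewrite norm_C_R, Cmod_mult.
  apply Rmult_le_compat_r; [apply Cmod_ge_0|now apply HM].
Qed.

Lemma Cmod_seg_point_sub (p q : C) (s t : R) :
  Cmod (seg_point p q s - seg_point p q t) = Rabs (s - t) * Cmod (q - p).
Proof.
  rewrite <- Cmod_R, <- Cmod_mult, RtoC_minus. f_equal. unfold seg_point. ring.
Qed.

Lemma seg_point_continuous (p q : C) (t : R) : continuous (U := C_topology) (seg_point p q) t.
Proof.
  apply filterlim_locally. intros eps. pose proof (Cmod_ge_0 (q - p)) as Hm.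
  assert (Hd : 0 < eps / (Cmod (q - p) + 1)) by (apply Rdiv_lt_0_compat; [apply cond_pos|lra]).
  exists (mkposreal _ Hd). intros s Hs. change (Rabs (s - t) < eps / (Cmod (q - p) + 1)) in Hs.
  change (Cmod (seg_point p q s - seg_point p q t) < eps). rewrite Cmod_seg_point_sub.
  apply Rlt_div_r in Hs; [|lra].
  pose proof (Rabs_pos (s - t)). lra.
Qed.

Lemma seg_integrand_continuous (g : C -> C) (p q : C) (t : R) :
  Ccontinuous g (seg_point p q t) ->
  continuous (U := C_R_NormedModule) (fun s => g (seg_point p q s) * (q - p))%C t.
Proof.
  intros Hg.
  assert (H : continuous (U := C_topology) (fun s => g (seg_point p q s) * (q - p))%C t).
  { apply (continuous_mult (K := C_AbsRing)); [|apply continuous_const].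
    apply (continuous_comp (V := C_topology)); [apply seg_point_continuous|exact Hg]. }
  intros P HP. apply H. now apply locally_C.
Qed.

Lemma ex_seg_int_continuous (g : C -> C) (p q : C) :
  (forall t, 0 <= t <= 1 -> Ccontinuous g (seg_point p q t)) -> ex_seg_int g p q.
Proof.
  intros Hg. apply (ex_RInt_continuous (V := C_R_CompleteNormedModule)). intros t Ht.
  rewrite Rmin_left, Rmax_right in Ht by lra. now apply seg_integrand_continuous, Hg.
Qed.

Lemma is_derive_seg_point (G : C -> C) (p q l : C) (t : R) :
  is_Cderive G (seg_point p q t) l ->
  is_derive (V := C_R_NormedModule) (fun s => G (seg_point p q s)) t (l * (q - p))%C.
Proof.
  intros HG. split; [apply (is_linear_scal_l (V := C_R_NormedModule))|]. intros x Hx.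
  apply (is_filter_lim_locally_unique (V := R_NormedModule)) in Hx. subst x.
  intros eps. set (m := Cmod (q - p)). assert (Hm : 0 <= m) by apply Cmod_ge_0.
  assert (He : 0 < eps / (m + 1)) by (apply Rdiv_lt_0_compat; [apply cond_pos|lra]).
  destruct (proj1 (is_Cderive_eps _ _ _) HG _ He) as [d [Hd H]].
  pose proof (proj1 (filterlim_locally _ _) (seg_point_continuous p q t) (mkposreal _ Hd)) as Hc.
  revert Hc. apply filter_imp. intros s Hs. specialize (H _ Hs).
  rewrite norm_C_R, scal_C_R.
  change (Cmod (G (seg_point p q s) - G (seg_point p q t) - RtoC (s - t) * (l * (q - p)))
          <= eps * Rabs (s - t)).
  replace (RtoC (s - t) * (l * (q - p)))%C with ((seg_point p q s - seg_point p q t) * l)%C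
    by (rewrite RtoC_minus; unfold seg_point; ring).
  eapply Rle_trans; [exact H|]. rewrite Cmod_seg_point_sub. fold m.
  replace (eps / (m + 1) * (Rabs (s - t) * m)) with (eps * Rabs (s - t) * (m / (m + 1)))
    by (field; lra).
  rewrite <- Rmult_1_r. apply Rmult_le_compat_l.
  - apply Rmult_le_pos; [left; apply cond_pos|apply Rabs_pos].
  - apply Rle_div_l; lra.
Qed.

Lemma is_seg_int_primitive (G g : C -> C) (p q : C) :
  (forall t, 0 <= t <= 1 -> is_Cderive G (seg_point p q t) (g (seg_point p q t))) ->
  (forall t, 0 <= t <= 1 -> Ccontinuous g (seg_point p q t)) ->
  is_seg_int g p q (G q - G p)%C.
Proof.
  intros HG Hg.
  replace (G q - G p)%C
    with (minus (G := C_R_NormedModule) (G (seg_point p q 1)) (G (seg_point p q 0))).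
  - apply (is_RInt_derive (V := C_R_CompleteNormedModule) (fun t => G (seg_point p q t)));
      intros t Ht; rewrite Rmin_left, Rmax_right in Ht by lra.
    + now apply is_derive_seg_point, HG.
    + now apply seg_integrand_continuous, Hg.
  - change (G (seg_point p q 1) - G (seg_point p q 0) = G q - G p)%C.
    unfold seg_point. f_equal; [|f_equal]; f_equal; ring.
Qed.

Lemma seg_int_plus (g k : C -> C) (p q : C) : ex_seg_int g p q -> ex_seg_int k p q ->
  seg_int (fun u => g u + k u)%C p q = (seg_int g p q + seg_int k p q)%C.
Proof.
  intros Hg Hk. now apply is_seg_int_unique, is_seg_int_plus; apply seg_int_correct.
Qed.

Lemma seg_int_scal (c : C) (g : C -> C) (p q : C) : ex_seg_int g p q ->
  seg_int (fun u => c * g u)%C p q = (c * seg_int g p q)%C.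
Proof. intros Hg. now apply is_seg_int_unique, is_seg_int_scal, seg_int_correct. Qed.

Lemma seg_int_reverse (g : C -> C) (p q : C) : ex_seg_int g p q ->
  seg_int g q p = (- seg_int g p q)%C.
Proof. intros Hg. now apply is_seg_int_unique, is_seg_int_reverse, seg_int_correct. Qed.

Lemma seg_int_Chasles (g : C -> C) (p q : C) (s : R) : 0 < s < 1 ->
  ex_seg_int g p (seg_point p q s) -> ex_seg_int g (seg_point p q s) q ->
  seg_int g p q = (seg_int g p (seg_point p q s) + seg_int g (seg_point p q s) q)%C.
Proof.
  intros Hs Hleft Hright.
  now apply is_seg_int_unique, is_seg_int_Chasles with s; try apply seg_int_correct.
Qed.

Lemma seg_int_bound (g : C -> C) (p q : C) (M : R) : ex_seg_int g p q ->
  (forall t, 0 <= t <= 1 -> Cmod (g (seg_point p q t)) <= M) ->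
  Cmod (seg_int g p q) <= Cmod (q - p) * M.
Proof. intros Hg HM. now apply (is_seg_int_bound g), seg_int_correct. Qed.

Lemma seg_point_h (a b y t : R) : seg_point (a, y) (b, y) t = (a + t * (b - a), y).
Proof. unfold seg_point, Cminus, Cplus, Cmult, Copp, RtoC; simpl. f_equal; ring. Qed.

Lemma seg_point_v (x a b t : R) : seg_point (x, a) (x, b) t = (x, a + t * (b - a)).
Proof. unfold seg_point, Cminus, Cplus, Cmult, Copp, RtoC; simpl. f_equal; ring. Qed.

Lemma ratio_between (a m b : R) : a < m < b -> 0 < (m - a) / (b - a) < 1.
Proof.
  intros Hm. split; [apply Rdiv_lt_0_compat; lra|]. apply Rlt_div_l; lra.
Qed.

Lemma seg_int_Chasles_h (g : C -> C) (a m b y : R) : a < m < b ->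
  ex_seg_int g (a, y) (m, y) -> ex_seg_int g (m, y) (b, y) ->
  seg_int g (a, y) (b, y) = (seg_int g (a, y) (m, y) + seg_int g (m, y) (b, y))%C.
Proof.
  intros Hm. replace ((m, y) : C) with (seg_point (a, y) (b, y) ((m - a) / (b - a))).
  - now apply seg_int_Chasles, ratio_between.
  - rewrite seg_point_h. f_equal. field. lra.
Qed.

Lemma seg_int_Chasles_v (g : C -> C) (x a m b : R) : a < m < b ->
  ex_seg_int g (x, a) (x, m) -> ex_seg_int g (x, m) (x, b) ->
  seg_int g (x, a) (x, b) = (seg_int g (x, a) (x, m) + seg_int g (x, m) (x, b))%C.
Proof.
  intros Hm. replace ((x, m) : C) with (seg_point (x, a) (x, b) ((m - a) / (b - a))).
  - now apply seg_int_Chasles, ratio_between.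
  - rewrite seg_point_v. f_equal. field. lra.
Qed.

(** * Cauchy's theorem on rectangles *)

Definition oint (g : C -> C) (x0 x1 y0 y1 : R) : C :=
  (seg_int g (x0, y0) (x1, y0) + seg_int g (x1, y0) (x1, y1)
   - seg_int g (x0, y1) (x1, y1) - seg_int g (x0, y0) (x0, y1))%C.

Definition in_rect (x0 x1 y0 y1 : R) (u : C) : Prop :=
  x0 <= Re u <= x1 /\ y0 <= Im u <= y1.

Definition in_interior (x0 x1 y0 y1 : R) (u : C) : Prop :=
  x0 < Re u < x1 /\ y0 < Im u < y1.

Definition on_edge (x0 x1 y0 y1 : R) (u : C) : Prop :=
  in_rect x0 x1 y0 y1 u /\ ~ in_interior x0 x1 y0 y1 u.

Section Rectangle.
Variables x0 x1 y0 y1 : R.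
Hypotheses (Hx : x0 <= x1) (Hy : y0 <= y1).

Lemma seg_point_on_edge_h (a b y t : R) : x0 <= a <= b -> b <= x1 -> y = y0 \/ y = y1 ->
  0 <= t <= 1 -> on_edge x0 x1 y0 y1 (seg_point (a, y) (b, y) t).
Proof.
  intros Ha Hb Hy' Ht. rewrite seg_point_h. unfold on_edge, in_rect, in_interior; simpl.
  repeat split; destruct Hy'; nra.
Qed.

Lemma seg_point_on_edge_v (x a b t : R) : x = x0 \/ x = x1 -> y0 <= a <= b -> b <= y1 ->
  0 <= t <= 1 -> on_edge x0 x1 y0 y1 (seg_point (x, a) (x, b) t).
Proof.
  intros Hx' Ha Hb Ht. rewrite seg_point_v. unfold on_edge, in_rect, in_interior; simpl.
  repeat split; destruct Hx'; nra.
Qed.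

Lemma ex_seg_int_edge_h (g : C -> C) (a b y : R) :
  (forall u, on_edge x0 x1 y0 y1 u -> Ccontinuous g u) ->
  x0 <= a <= b -> b <= x1 -> y = y0 \/ y = y1 -> ex_seg_int g (a, y) (b, y).
Proof.
  intros Hg Ha Hb Hy'. apply ex_seg_int_continuous. intros t Ht.
  now apply Hg, seg_point_on_edge_h.
Qed.

Lemma ex_seg_int_edge_v (g : C -> C) (x a b : R) :
  (forall u, on_edge x0 x1 y0 y1 u -> Ccontinuous g u) ->
  x = x0 \/ x = x1 -> y0 <= a <= b -> b <= y1 -> ex_seg_int g (x, a) (x, b).
Proof.
  intros Hg Hx' Ha Hb. apply ex_seg_int_continuous. intros t Ht.
  now apply Hg, seg_point_on_edge_v.
Qed.

Lemma ex_seg_int_edges (g : C -> C) :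
  (forall u, on_edge x0 x1 y0 y1 u -> Ccontinuous g u) ->
  ex_seg_int g (x0, y0) (x1, y0) /\ ex_seg_int g (x1, y0) (x1, y1) /\
  ex_seg_int g (x0, y1) (x1, y1) /\ ex_seg_int g (x0, y0) (x0, y1).
Proof.
  intros Hg.
  repeat split; (apply ex_seg_int_edge_h + apply ex_seg_int_edge_v); auto; lra.
Qed.

Lemma oint_plus (g k : C -> C) :
  (forall u, on_edge x0 x1 y0 y1 u -> Ccontinuous g u) ->
  (forall u, on_edge x0 x1 y0 y1 u -> Ccontinuous k u) ->
  oint (fun u => g u + k u)%C x0 x1 y0 y1
    = (oint g x0 x1 y0 y1 + oint k x0 x1 y0 y1)%C.
Proof.
  intros Hg Hk. apply ex_seg_int_edges in Hg. apply ex_seg_int_edges in Hk.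
  unfold oint. rewrite !seg_int_plus by tauto. ring.
Qed.

Lemma oint_scal (c : C) (g : C -> C) :
  (forall u, on_edge x0 x1 y0 y1 u -> Ccontinuous g u) ->
  oint (fun u => c * g u)%C x0 x1 y0 y1 = (c * oint g x0 x1 y0 y1)%C.
Proof.
  intros Hg. apply ex_seg_int_edges in Hg.
  unfold oint. rewrite !seg_int_scal by tauto. ring.
Qed.

Lemma oint_bound (g : C -> C) (M : R) :
  (forall u, on_edge x0 x1 y0 y1 u -> Ccontinuous g u) ->
  (forall u, on_edge x0 x1 y0 y1 u -> Cmod (g u) <= M) ->
  Cmod (oint g x0 x1 y0 y1) <= 2 * ((x1 - x0) + (y1 - y0)) * M.
Proof.
  intros Hg HM. apply ex_seg_int_edges in Hg. destruct Hg as [Ebot [Eright [Etop Eleft]]].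
  assert (Hlen_h : forall a b y : R, Cmod ((b, y) - (a, y)) = Rabs (b - a)).
  { intros a b y. rewrite <- Cmod_R. f_equal.
    unfold Cminus, Cplus, Copp, RtoC; simpl. f_equal; ring. }
  assert (Hlen_v : forall x a b : R, Cmod ((x, b) - (x, a)) = Rabs (b - a)).
  { intros x a b. rewrite <- Cmod_R, <- (Rmult_1_l (Cmod (b - a)%R)), <- Cmod_Ci, <- Cmod_mult.
    f_equal. unfold Cminus, Cplus, Copp, Cmult, Ci, RtoC; simpl. f_equal; ring. }
  apply (seg_int_bound g _ _ M) in Ebot, Etop;
    try (intros t Ht; apply HM, seg_point_on_edge_h; auto; lra).
  apply (seg_int_bound g _ _ M) in Eleft, Eright;
    try (intros t Ht; apply HM, seg_point_on_edge_v; auto; lra).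
  rewrite Hlen_h, Rabs_pos_eq in Ebot, Etop by lra.
  rewrite Hlen_v, Rabs_pos_eq in Eleft, Eright by lra.
  unfold oint, Cminus at 1 2.
  eapply Rle_trans; [apply Cmod_triangle|].
  eapply Rle_trans; [apply Rplus_le_compat_r, Cmod_triangle|].
  eapply Rle_trans; [apply Rplus_le_compat_r, Rplus_le_compat_r, Cmod_triangle|].
  rewrite !Cmod_opp. lra.
Qed.

Lemma oint_primitive (G g : C -> C) :
  (forall u, on_edge x0 x1 y0 y1 u -> is_Cderive G u (g u)) ->
  (forall u, on_edge x0 x1 y0 y1 u -> Ccontinuous g u) ->
  oint g x0 x1 y0 y1 = RtoC 0.
Proof.
  intros HG Hg.
  assert (Hseg : forall p q, (forall t, 0 <= t <= 1 -> on_edge x0 x1 y0 y1 (seg_point p q t)) ->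
            seg_int g p q = (G q - G p)%C).
  { intros p q Hpq. apply is_seg_int_unique, is_seg_int_primitive; auto. }
  unfold oint. rewrite !Hseg
    by (intros t Ht; (apply seg_point_on_edge_h + apply seg_point_on_edge_v); auto; lra).
  ring.
Qed.

Lemma oint_split_x (g : C -> C) (xm : R) : x0 < xm < x1 ->
  (forall u, on_edge x0 x1 y0 y1 u -> Ccontinuous g u) ->
  oint g x0 x1 y0 y1 = (oint g x0 xm y0 y1 + oint g xm x1 y0 y1)%C.
Proof.
  intros Hm Hg. unfold oint.
  rewrite (seg_int_Chasles_h g x0 xm x1 y0), (seg_int_Chasles_h g x0 xm x1 y1);
    try exact Hm; try (apply ex_seg_int_edge_h; auto; lra).
  ring.
Qed.

Lemma oint_split_y (g : C -> C) (ym : R) : y0 < ym < y1 ->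
  (forall u, on_edge x0 x1 y0 y1 u -> Ccontinuous g u) ->
  oint g x0 x1 y0 y1 = (oint g x0 x1 y0 ym + oint g x0 x1 ym y1)%C.
Proof.
  intros Hm Hg. unfold oint.
  rewrite (seg_int_Chasles_v g x0 y0 ym y1), (seg_int_Chasles_v g x1 y0 ym y1);
    try exact Hm; try (apply ex_seg_int_edge_v; auto; lra).
  ring.
Qed.

End Rectangle.

Lemma nested_intervals (a b : nat -> R) :
  (forall n, a n <= a (S n)) -> (forall n, b (S n) <= b n) -> (forall n, a n <= b n) ->
  exists X, forall n, a n <= X <= b n.
Proof.
  intros Ha Hb Hab.
  assert (Hb0 : forall n, b n <= b O).
  { induction n as [|n IH]; [lra|]. eapply Rle_trans; [apply Hb|exact IH]. }
  assert (Ha0 : forall n, a O <= a n).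
  { induction n as [|n IH]; [lra|]. eapply Rle_trans; [exact IH|apply Ha]. }
  destruct (ex_finite_lim_seq_incr a (b O) Ha) as [X HX].
  { intros n. eapply Rle_trans; [apply Hab|apply Hb0]. }
  destruct (ex_finite_lim_seq_decr b (a O) Hb) as [Y HY].
  { intros n. eapply Rle_trans; [apply Ha0|apply Hab]. }
  pose proof (is_lim_seq_le a b X Y Hab HX HY) as HXY. simpl in HXY.
  exists X. intros n. split; [now apply is_lim_seq_incr_compare|].
  eapply Rle_trans; [exact HXY|]. now apply is_lim_seq_decr_compare.
Qed.

(* Rectangles of the fixed shape [w * h] are recorded by their lower left corner
   and their scale. *)
Section Bisection.
Variables w h : R.
Hypotheses (Hw : 0 < w) (Hh : 0 < h).

Definition sub_rectangle (x' y' t' x y t : R) : Prop :=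
  x <= x' /\ x' + t' * w <= x + t * w /\ y <= y' /\ y' + t' * h <= y + t * h.

Lemma halving_sequence (Q : R -> R -> R -> Prop) (x0 y0 : R) :
  (forall x y t, 0 < t -> Q x y t ->
     exists x' y', Q x' y' (t / 2) /\ sub_rectangle x' y' (t / 2) x y t) ->
  Q x0 y0 1 ->
  exists X Y : nat -> R, forall n, Q (X n) (Y n) ((/ 2) ^ n) /\
    sub_rectangle (X (S n)) (Y (S n)) ((/ 2) ^ S n) (X n) (Y n) ((/ 2) ^ n).
Proof.
  intros Hhalf HQ0.
  destruct (functional_choice (fun s s' : R * R * R =>
             let '(x, y, t) := s in let '(x', y', t') := s' in
             0 < t -> Q x y t -> t' = t / 2 /\ Q x' y' t' /\ sub_rectangle x' y' t' x y t))
    as [next Hnext].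
  { intros [[x y] t]. destruct (classic (0 < t /\ Q x y t)) as [[Ht HQ]|Hn].
    - destruct (Hhalf x y t Ht HQ) as [x' [y' H]]. exists (x', y', t / 2). tauto.
    - exists (x, y, t). tauto. }
  set (c := nat_rect (fun _ => (R * R * R)%type) (x0, y0, 1) (fun _ => next)).
  assert (Hc : forall n, snd (c n) = (/ 2) ^ n /\
            Q (fst (fst (c n))) (snd (fst (c n))) (snd (c n))).
  { induction n as [|n [IHt IHQ]]; [split; [reflexivity|exact HQ0]|].
    simpl c. specialize (Hnext (c n)).
    destruct (c n) as [[x y] t], (next (x, y, t)) as [[x' y'] t']. simpl in *.
    assert (Ht : 0 < t) by (rewrite IHt; apply pow_lt; lra).
    destruct (Hnext Ht IHQ) as [-> [HQ' _]]. split; [rewrite IHt; field|exact HQ']. }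
  exists (fun n => fst (fst (c n))), (fun n => snd (fst (c n))). intros n.
  destruct (Hc n) as [Ht HQ], (Hc (S n)) as [Ht' _]. rewrite <- Ht, <- Ht'.
  split; [exact HQ|]. simpl c. specialize (Hnext (c n)).
  destruct (c n) as [[x y] t], (next (x, y, t)) as [[x' y'] t']. simpl in *.
  apply Hnext; [|exact HQ]. rewrite Ht. apply pow_lt. lra.
Qed.

Lemma rectangle_bisection (P : R -> R -> R -> Prop) (x0 y0 : R) :
  (forall x y t, 0 < t ->
     P x y (t / 2) -> P (x + t / 2 * w) y (t / 2) -> P x (y + t / 2 * h) (t / 2) ->
     P (x + t / 2 * w) (y + t / 2 * h) (t / 2) -> P x y t) ->
  (forall X Y, exists d, 0 < d /\ forall x y t, 0 < t < d ->
     x <= X <= x + t * w -> y <= Y <= y + t * h -> P x y t) ->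
  P x0 y0 1.
Proof.
  intros Hquarter Hlocal. apply NNPP. intros HnP.
  destruct (halving_sequence (fun x y t => ~ P x y t) x0 y0) as [X [Y HXY]]; [|exact HnP|].
  { intros x y t Ht Hn. apply NNPP. intros Hno.
    assert (0 < t / 2 * w) by (apply Rmult_lt_0_compat; lra).
    assert (0 < t / 2 * h) by (apply Rmult_lt_0_compat; lra).
    apply Hn, Hquarter; [exact Ht| | | |]; apply NNPP; intros Hq; apply Hno;
      do 2 eexists; (split; [exact Hq|unfold sub_rectangle; repeat split; lra]). }
  assert (Hpow : forall n, 0 < (/ 2) ^ n) by (intros n; apply pow_lt; lra).
  destruct (nested_intervals X (fun n => X n + (/ 2) ^ n * w)) as [x Hx];
    try (intros n; apply HXY).
  { intros n. specialize (Hpow n). nra. }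
  destruct (nested_intervals Y (fun n => Y n + (/ 2) ^ n * h)) as [y Hy];
    try (intros n; apply HXY).
  { intros n. specialize (Hpow n). nra. }
  destruct (Hlocal x y) as [d [Hd H]].
  destruct (pow_lt_1_zero (/ 2)) with d as [N HN]; [rewrite Rabs_pos_eq; lra|exact Hd|].
  destruct (HXY N) as [HnN _]. apply HnN, H; auto. split; [apply Hpow|].
  eapply Rle_lt_trans; [apply Rle_abs|]. apply HN. lia.
Qed.

End Bisection.

Lemma Cmod_sub_in_rect (x0 x1 y0 y1 : R) (u p : C) :
  in_rect x0 x1 y0 y1 u -> in_rect x0 x1 y0 y1 p -> Cmod (u - p) <= (x1 - x0) + (y1 - y0).
Proof.
  intros [Hu1 Hu2] [Hp1 Hp2]. destruct u as [a b], p as [a' b']. simpl in *.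
  unfold Cminus, Cplus, Copp; simpl.
  eapply Rle_trans; [apply Cmod_le_abs|]. apply Rplus_le_compat; apply Rabs_le; lra.
Qed.

(* The affine part of the expansion of [g] at [p] has a primitive. *)
Lemma oint_bound_at_derivable (g : C -> C) (p l : C) (eps : R) : 0 < eps ->
  is_Cderive g p l ->
  exists d, 0 < d /\ forall x0 x1 y0 y1, in_rect x0 x1 y0 y1 p ->
    (x1 - x0) + (y1 - y0) < d ->
    (forall u, on_edge x0 x1 y0 y1 u -> Ccontinuous g u) ->
    Cmod (oint g x0 x1 y0 y1) <= 2 * eps * ((x1 - x0) + (y1 - y0)) ^ 2.
Proof.
  intros He Hl. destruct (proj1 (is_Cderive_eps g p l) Hl eps He) as [d [Hd H]].
  exists d. split; [exact Hd|]. intros x0 x1 y0 y1 Hp Hsize Hg.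
  set (aff := fun u => (- g p + (- l * u + l * p))%C).
  assert (Hx : x0 <= x1) by (destruct Hp; lra). assert (Hy : y0 <= y1) by (destruct Hp; lra).
  assert (Hder : forall u, is_Cderive aff u (- l)%C).
  { intros u. eapply is_Cderive_eq.
    - apply is_Cderive_plus; [apply is_Cderive_const|].
      apply is_Cderive_plus; [apply is_Cderive_scal, is_Cderive_id|apply is_Cderive_const].
    - ring. }
  assert (Haff : oint aff x0 x1 y0 y1 = RtoC 0).
  { apply oint_primitive with (fun u => (- g p * u + (- l / 2 * (u * u) + l * p * u))%C); auto.
    - intros u _. eapply is_Cderive_eq.
      + apply is_Cderive_plus; [apply is_Cderive_scal, is_Cderive_id|].
        apply is_Cderive_plus; [|apply is_Cderive_scal, is_Cderive_id].
        apply is_Cderive_scal, is_Cderive_mult; apply is_Cderive_id.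
      + unfold aff. cbv beta. field.
    - intros u _. exact (is_Cderive_continuous _ _ _ (Hder u)). }
  replace (oint g x0 x1 y0 y1) with (oint (fun u => g u + aff u)%C x0 x1 y0 y1).
  - replace (2 * eps * ((x1 - x0) + (y1 - y0)) ^ 2)
      with (2 * ((x1 - x0) + (y1 - y0)) * (eps * ((x1 - x0) + (y1 - y0)))) by ring.
    apply oint_bound; auto.
    + intros u Hu. apply Ccontinuous_plus; [auto|exact (is_Cderive_continuous _ _ _ (Hder u))].
    + intros u [Hu _]. pose proof (Cmod_sub_in_rect _ _ _ _ u p Hu Hp) as Hup.
      replace (g u + aff u)%C with (g u - g p - (u - p) * l)%C by (unfold aff; ring).
      eapply Rle_trans; [apply H; lra|]. apply Rmult_le_compat_l; lra.
  - rewrite oint_plus, Haff; auto; [ring|].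
    intros u _. exact (is_Cderive_continuous _ _ _ (Hder u)).
Qed.

Lemma Cmod_oint_le_quarters (g : C -> C) (x y a b M : R) : 0 < a -> 0 < b ->
  (forall u, in_rect x (x + (a + a)) y (y + (b + b)) u -> Ccontinuous g u) ->
  Cmod (oint g x (x + a) y (y + b)) <= M ->
  Cmod (oint g (x + a) (x + a + a) y (y + b)) <= M ->
  Cmod (oint g x (x + a) (y + b) (y + b + b)) <= M ->
  Cmod (oint g (x + a) (x + a + a) (y + b) (y + b + b)) <= M ->
  Cmod (oint g x (x + (a + a)) y (y + (b + b))) <= 4 * M.
Proof.
  intros Ha Hb Hg Hsw Hse Hnw Hne.
  rewrite (oint_split_x x (x + (a + a)) y (y + (b + b))) with (xm := x + a);
    [|lra|lra|intros u [Hu _]; auto].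
  rewrite (oint_split_y x (x + a) y (y + (b + b))) with (ym := y + b);
    [|lra|lra|intros u [Hu _]; apply Hg; unfold in_rect in *; lra].
  rewrite (oint_split_y (x + a) (x + (a + a)) y (y + (b + b))) with (ym := y + b);
    [|lra|lra|intros u [Hu _]; apply Hg; unfold in_rect in *; lra].
  rewrite <- !Rplus_assoc.
  eapply Rle_trans; [apply Cmod_triangle|].
  eapply Rle_trans; [apply Rplus_le_compat; apply Cmod_triangle|]. lra.
Qed.

Lemma Cmod_eps_eq_0 (a : C) (k : R) : 0 < k ->
  (forall eps, 0 < eps -> Cmod a <= eps * k) -> a = RtoC 0.
Proof.
  intros Hk H. apply Cmod_eq_0, Rle_antisym; [|apply Cmod_ge_0].
  apply le_epsilon. intros eps He. rewrite Rplus_0_l.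
  replace eps with (eps / k * k) by (field; lra). apply H. now apply Rdiv_lt_0_compat.
Qed.

Lemma goursat (g : C -> C) (x0 x1 y0 y1 : R) : x0 < x1 -> y0 < y1 ->
  (forall u, in_rect x0 x1 y0 y1 u -> ex_Cderive g u) ->
  oint g x0 x1 y0 y1 = RtoC 0.
Proof.
  intros Hx Hy Hg. set (w := x1 - x0). set (h := y1 - y0).
  assert (Hw : 0 < w) by (unfold w; lra). assert (Hh : 0 < h) by (unfold h; lra).
  assert (Ex : x0 + w = x1) by (unfold w; ring). assert (Ey : y0 + h = y1) by (unfold h; ring).
  apply Cmod_eps_eq_0 with (2 * (w + h) ^ 2); [nra|]. intros eps He.
  set (P := fun x y t : R => sub_rectangle w h x y t x0 y0 1 ->
    Cmod (oint g x (x + t * w) y (y + t * h)) <= eps * (2 * (w + h) ^ 2) * t ^ 2).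
  cut (P x0 y0 1).
  { unfold P, sub_rectangle. rewrite !Rmult_1_l, pow1, Rmult_1_r.
    rewrite Ex, Ey. intros HP. apply HP. lra. }
  apply (rectangle_bisection w h Hw Hh P); unfold P, sub_rectangle.
  - intros x y t Ht Hsw Hse Hnw Hne Hsub.
    assert (Ha : 0 < t / 2 * w) by (apply Rmult_lt_0_compat; lra).
    assert (Hb : 0 < t / 2 * h) by (apply Rmult_lt_0_compat; lra).
    replace (t * w) with (t / 2 * w + t / 2 * w) in * by field.
    replace (t * h) with (t / 2 * h + t / 2 * h) in * by field.
    replace (eps * (2 * (w + h) ^ 2) * t ^ 2)
      with (4 * (eps * (2 * (w + h) ^ 2) * (t / 2) ^ 2)) by field.
    apply Cmod_oint_le_quarters; auto;
      [|apply Hsw; lra|apply Hse; lra|apply Hnw; lra|apply Hne; lra].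
    intros u Hu. apply ex_Cderive_continuous, Hg. unfold in_rect in *. lra.
  - intros X Y. destruct (classic (in_rect x0 x1 y0 y1 (X, Y))) as [HXY|HXY].
    + destruct (Hg _ HXY) as [l Hl].
      destruct (oint_bound_at_derivable g (X, Y) l eps He Hl) as [d [Hd H]].
      exists (d / (w + h)). split; [apply Rdiv_lt_0_compat; lra|].
      intros x y t [Ht Htd] HX HY Hsub.
      assert (Htwh : t * (w + h) < d).
      { apply Rlt_div_r; lra. }
      replace (eps * (2 * (w + h) ^ 2) * t ^ 2)
        with (2 * eps * ((x + t * w - x) + (y + t * h - y)) ^ 2) by ring.
      apply H; [now split|lra|].
      intros u [Hu _]. apply ex_Cderive_continuous, Hg. unfold in_rect in *. lra.
    + exists 1. split; [lra|]. intros x y t _ HX HY Hsub. exfalso. apply HXY.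
      unfold in_rect; simpl. lra.
Qed.

(** * The residue theorem on rectangles *)

(* Only removable singularities and simple poles have a residue in this sense. *)
Definition is_residue (g : C -> C) (p c : C) : Prop :=
  filterlim (fun u => (u - p) * g u)%C
    (locally' (T := C_topology) p) (locally (T := C_topology) c).

Lemma is_residue_eps (g : C -> C) (p c : C) : is_residue g p c ->
  forall eps, 0 < eps -> exists d, 0 < d /\
    forall u, u <> p -> Cmod (u - p) < d -> Cmod ((u - p) * g u - c) < eps.
Proof.
  intros H eps He.
  destruct (proj1 (filterlim_locally (U := C_topology) _ c) H (mkposreal _ He)) as [d Hd].
  exists d. split; [apply cond_pos|]. intros u Hu Hud. exact (Hd u Hud Hu).
Qed.

Lemma is_residue_ext (g k : C -> C) (p c : C) :
  (forall u, g u = k u) -> is_residue g p c -> is_residue k p c.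
Proof. intros H. apply filterlim_ext. intros u. now rewrite H. Qed.

Lemma Ccontinuous_locally' (k : C -> C) (p : C) : Ccontinuous k p ->
  filterlim k (locally' (T := C_topology) p) (locally (T := C_topology) (k p)).
Proof. apply filterlim_filter_le_1, filter_le_within. Qed.

Lemma is_residue_plus (g k : C -> C) (p a b : C) :
  is_residue g p a -> is_residue k p b -> is_residue (fun u => g u + k u)%C p (a + b).
Proof.
  intros Hg Hk.
  apply filterlim_ext with (fun u => ((u - p) * g u + (u - p) * k u)%C); [intros u; ring|].
  eapply filterlim_comp_2; [exact Hg|exact Hk|].
  apply (filterlim_plus (V := AbsRing_NormedModule C_AbsRing)).
Qed.

Lemma is_residue_mult (g k : C -> C) (p c : C) :
  is_residue g p c -> Ccontinuous k p -> is_residue (fun u => g u * k u)%C p (c * k p).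
Proof.
  intros Hg Hk.
  apply filterlim_ext with (fun u => ((u - p) * g u * k u)%C); [intros u; ring|].
  eapply filterlim_comp_2; [exact Hg|exact (Ccontinuous_locally' k p Hk)|].
  apply (filterlim_mult (K := C_AbsRing)).
Qed.

Lemma is_residue_pole (c p : C) : is_residue (fun u => c * / (u - p))%C p c.
Proof.
  apply (filterlim_locally (U := C_topology)). intros eps. exists eps. intros u _ Hu.
  replace ((u - p) * (c * / (u - p)))%C with c by (field; now apply Cminus_eq_contra).
  apply ball_center.
Qed.

Lemma is_residue_continuous (k : C -> C) (p : C) : Ccontinuous k p -> is_residue k p 0.
Proof.
  intros Hk. unfold is_residue.
  replace (RtoC 0) with ((p - p) * k p)%C by ring.
  apply (Ccontinuous_locally' (fun u => (u - p) * k u)%C), Ccontinuous_mult; [|exact Hk].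
  eapply is_Cderive_continuous, is_Cderive_minus; [apply is_Cderive_id|apply is_Cderive_const].
Qed.

Lemma is_residue_div (A B : C -> C) (p b : C) :
  Ccontinuous A p -> is_Cderive B p b -> B p = RtoC 0 -> b <> RtoC 0 ->
  is_residue (fun u => A u / B u)%C p (A p / b).
Proof.
  intros HA HB HB0 Hb.
  assert (Hquot : filterlim (fun u => B u / (u - p))%C
            (locally' (T := C_topology) p) (locally (T := C_topology) b)).
  { apply (filterlim_locally (U := C_topology)). intros eps.
    destruct (proj1 (is_Cderive_eps B p b) HB (eps / 2)) as [d [Hd H]]; [apply is_pos_div_2|].
    exists (mkposreal _ Hd). intros u Hud Hu. specialize (H u Hud). rewrite HB0 in H.
    change (Cmod (B u / (u - p) - b) < eps).
    assert (Hup : (u - p)%C <> RtoC 0) by now apply Cminus_eq_contra.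
    replace (B u / (u - p) - b)%C with ((B u - 0 - (u - p) * b) / (u - p))%C
      by (field; exact Hup).
    rewrite Cmod_div by exact Hup. apply Cmod_gt_0 in Hup.
    apply Rlt_div_l; [exact Hup|]. pose proof (cond_pos eps). nra. }
  assert (HC0 : (/ RtoC 0)%C = RtoC 0)
    by (unfold Cinv, RtoC; simpl; f_equal; unfold Rdiv; ring).
  apply filterlim_ext with (fun u => A u * / (B u / (u - p)))%C.
  { intros u. destruct (classic (B u = RtoC 0)) as [HBu|HBu].
    - rewrite HBu. unfold Cdiv. rewrite Cmult_0_l, HC0. ring.
    - field. split; [exact HBu|]. apply Cminus_eq_contra. intros ->. contradiction. }
  eapply filterlim_comp_2; [exact (Ccontinuous_locally' A p HA)| |].
  - eapply filterlim_comp; [exact Hquot|].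
    exact (is_Cderive_continuous Cinv b _ (is_Cderive_inv b Hb)).
  - apply (filterlim_mult (K := C_AbsRing)).
Qed.

Lemma exists_below_positive_elements (L : list R) (d : R) : 0 < d ->
  exists e, 0 < e < d /\ forall x, In x L -> 0 < x -> e < x.
Proof.
  intros Hd. induction L as [|x L [e [He IH]]].
  - exists (d / 2). split; [lra|]. intros x [].
  - destruct (Rlt_le_dec 0 x) as [Hx|Hx].
    + exists (Rmin e (x / 2)). pose proof (Rmin_l e (x / 2)). pose proof (Rmin_r e (x / 2)).
      assert (0 < Rmin e (x / 2)) by (apply Rmin_glb_lt; lra).
      split; [lra|]. intros y [<-|Hy] Hy0; [lra|]. specialize (IH y Hy Hy0). lra.
    + exists e. split; [exact He|]. intros y [<-|Hy] Hy0; [lra|auto].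
Qed.

Definition off_lines (xs ys : list R) (q : C) : Prop := ~ In (Re q) xs /\ ~ In (Im q) ys.

Lemma exists_isolating_square (p : C) (l : list C) (x0 x1 y0 y1 d : R) : 0 < d ->
  in_interior x0 x1 y0 y1 p ->
  exists e, 0 < e < d /\ (x0 < Re p - e /\ Re p + e < x1) /\ (y0 < Im p - e /\ Im p + e < y1) /\
    forall q, In q (p :: l) -> off_lines [Re p - e; Re p + e] [Im p - e; Im p + e] q.
Proof.
  intros Hd [Hpx Hpy].
  set (dist_x := fun q => Rabs (Re q - Re p)). set (dist_y := fun q => Rabs (Im q - Im p)).
  destruct (exists_below_positive_elements ([Re p - x0; x1 - Re p; Im p - y0; y1 - Im p]
              ++ map dist_x l ++ map dist_y l) d Hd) as [e [He Hlt]].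
  pose proof (Hlt (Re p - x0)). pose proof (Hlt (x1 - Re p)).
  pose proof (Hlt (Im p - y0)). pose proof (Hlt (y1 - Im p)).
  exists e. split; [exact He|]. simpl in *. do 2 (split; [lra|]).
  intros q [<-|Hq]; [unfold off_lines; simpl; repeat split; lra|].
  assert (Hx : dist_x q <> e).
  { intros Ex. apply (Rlt_irrefl e). rewrite <- Ex at 2. apply Hlt; [|lra].
    do 4 right. apply in_or_app. left. now apply in_map. }
  assert (Hy : dist_y q <> e).
  { intros Ey. apply (Rlt_irrefl e). rewrite <- Ey at 2. apply Hlt; [|lra].
    do 4 right. apply in_or_app. right. now apply in_map. }
  unfold off_lines; simpl. unfold dist_x, dist_y, Rabs in Hx, Hy.
  destruct (Rcase_abs (Re q - Re p)), (Rcase_abs (Im q - Im p));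
    split; intros [Eq|[Eq|[]]]; lra.
Qed.

Lemma on_edge_not_off_lines (x0 x1 y0 y1 : R) (u : C) :
  on_edge x0 x1 y0 y1 u -> ~ off_lines [x0; x1] [y0; y1] u.
Proof.
  intros [[Hx Hy] Hu] [Hx' Hy']. simpl in Hx', Hy'. apply Hu. split; split.
  all: apply Rnot_le_lt; intros H; (apply Hx' + apply Hy'); lra.
Qed.

Lemma le_Cmod_on_square (p u : C) (e : R) : 0 < e ->
  on_edge (Re p - e) (Re p + e) (Im p - e) (Im p + e) u -> e <= Cmod (u - p).
Proof.
  intros He [_ Hu]. apply Rnot_lt_le. intros H. apply Hu.
  pose proof (re_le_Cmod (u - p)) as Hre. pose proof (im_le_Cmod (u - p)) as Him.
  rewrite re_minus in Hre. rewrite im_minus in Him.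
  apply Rabs_le_between in Hre, Him. unfold in_interior. lra.
Qed.

Lemma oint_small_square (g : C -> C) (p : C) (eps : R) : 0 < eps -> is_residue g p 0 ->
  exists d, 0 < d /\ forall e, 0 < e < d ->
    (forall u, on_edge (Re p - e) (Re p + e) (Im p - e) (Im p + e) u -> Ccontinuous g u) ->
    Cmod (oint g (Re p - e) (Re p + e) (Im p - e) (Im p + e)) <= eps * 8.
Proof.
  intros Heps Hres. destruct (is_residue_eps g p 0 Hres eps Heps) as [d [Hd H]].
  exists (d / 4). split; [lra|]. intros e He Hg.
  replace (eps * 8) with (2 * ((Re p + e - (Re p - e)) + (Im p + e - (Im p - e))) * (eps / e))
    by (field; lra).
  apply oint_bound; [lra|lra|exact Hg|]. intros u Hu.
  pose proof (le_Cmod_on_square p u e (proj1 He) Hu) as Hlow.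
  assert (Hup : Cmod (u - p) <= 4 * e).
  { destruct Hu as [Hu _].
    eapply Rle_trans; [apply (Cmod_sub_in_rect _ _ _ _ u p Hu)|]; unfold in_rect; lra. }
  assert (Hne : u <> p).
  { intros ->. replace (p - p)%C with (RtoC 0) in Hlow by ring. rewrite Cmod_0 in Hlow. lra. }
  specialize (H u Hne ltac:(lra)).
  replace ((u - p) * g u - 0)%C with ((u - p) * g u)%C in H by ring. rewrite Cmod_mult in H.
  apply Rmult_le_reg_l with e; [lra|]. replace (e * (eps / e)) with eps by (field; lra).
  pose proof (Cmod_ge_0 (g u)). nra.
Qed.

Lemma oint_frame (g : C -> C) (x0 a b x1 y0 c d y1 : R) :
  x0 < a < b -> b < x1 -> y0 < c < d -> d < y1 ->
  (forall u, in_rect x0 x1 y0 y1 u -> ~ off_lines [x0; a; b; x1] [y0; c; d; y1] u ->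
     Ccontinuous g u) ->
  oint g x0 x1 y0 y1
    = (oint g x0 a y0 y1 + oint g b x1 y0 y1 + oint g a b y0 c + oint g a b d y1
       + oint g a b c d)%C.
Proof.
  intros Hab Hb Hcd Hd Hg.
  assert (Hedge : forall a' b' c' d', In a' [x0; a; b; x1] -> In b' [x0; a; b; x1] ->
            In c' [y0; c; d; y1] -> In d' [y0; c; d; y1] ->
            forall u, on_edge a' b' c' d' u -> Ccontinuous g u).
  { intros a' b' c' d' Ha' Hb' Hc' Hd' u Hu. apply Hg.
    - destruct Hu as [Hu _]. unfold in_rect in *. simpl in *.
      intuition (subst; lra).
    - intros [Hx Hy]. apply on_edge_not_off_lines in Hu. apply Hu.
      split; intros [E|[E|[]]]; (apply Hx + apply Hy); rewrite <- E; assumption. }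
  rewrite (oint_split_x x0 x1 y0 y1) with (xm := a); [|lra|lra|apply Hedge; simpl; tauto].
  rewrite (oint_split_x a x1 y0 y1) with (xm := b); [|lra|lra|apply Hedge; simpl; tauto].
  rewrite (oint_split_y a b y0 y1) with (ym := c); [|lra|lra|apply Hedge; simpl; tauto].
  rewrite (oint_split_y a b c y1) with (ym := d); [|lra|lra|apply Hedge; simpl; tauto].
  ring.
Qed.

Lemma in_rect_off_lines_interior (x0 x1 y0 y1 : R) (u : C) :
  in_rect x0 x1 y0 y1 u -> off_lines [x0; x1] [y0; y1] u -> in_interior x0 x1 y0 y1 u.
Proof.
  intros Hu Hoff. apply NNPP. intros Hn. now apply (on_edge_not_off_lines x0 x1 y0 y1 u).
Qed.

(* The cut lines around a singularity avoid all other singularities, so that the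
   four outer pieces satisfy the hypotheses again. *)
Lemma oint_zero_residues (g : C -> C) (l : list C) : forall x0 x1 y0 y1,
  x0 < x1 -> y0 < y1 ->
  (forall u, in_rect x0 x1 y0 y1 u -> ~ In u l -> ex_Cderive g u) ->
  (forall p, In p l -> off_lines [x0; x1] [y0; y1] p /\ is_residue g p 0) ->
  oint g x0 x1 y0 y1 = RtoC 0.
Proof.
  induction l as [|p l IH]; intros x0 x1 y0 y1 Hx Hy Hg Hl; [now apply goursat; auto|].
  assert (Houtside : forall a b c d, a < b -> c < d ->
            (forall u, in_rect a b c d u -> in_rect x0 x1 y0 y1 u) ->
            ~ in_rect a b c d p ->
            (forall q, In q l -> off_lines [a; b] [c; d] q) -> oint g a b c d = RtoC 0).
  { intros a b c d Hab Hcd Hsub Hp Hoff. apply IH; auto.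
    - intros u Hu Hul. apply Hg; [auto|]. intros [<-|Hul']; contradiction.
    - intros q Hq. split; [auto|]. apply Hl. now right. }
  destruct (Hl p (or_introl eq_refl)) as [Hpoff Hres].
  destruct (classic (in_rect x0 x1 y0 y1 p)) as [Hp|Hp].
  2: { apply Houtside; auto. intros q Hq. apply Hl. now right. }
  apply Cmod_eps_eq_0 with 8; [lra|]. intros eps Heps.
  destruct (oint_small_square g p eps Heps Hres) as [d [Hd Hsq]].
  destruct (exists_isolating_square p l x0 x1 y0 y1 d Hd) as [e [He [Hpx [Hpy Hoff]]]].
  { now apply in_rect_off_lines_interior. }
  assert (Hcut : forall u, in_rect x0 x1 y0 y1 u ->
            ~ off_lines [x0; Re p - e; Re p + e; x1] [y0; Im p - e; Im p + e; y1] u ->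
            Ccontinuous g u).
  { intros u Hu Hlines. apply ex_Cderive_continuous, Hg; [exact Hu|]. intros Hul.
    pose proof (proj1 (Hl u Hul)). pose proof (Hoff u Hul).
    apply Hlines. unfold off_lines in *; simpl in *; tauto. }
  rewrite (oint_frame g x0 (Re p - e) (Re p + e) x1 y0 (Im p - e) (Im p + e) y1) by (auto; lra).
  rewrite (Houtside x0 (Re p - e) y0 y1), (Houtside (Re p + e) x1 y0 y1),
    (Houtside (Re p - e) (Re p + e) y0 (Im p - e)), (Houtside (Re p - e) (Re p + e) (Im p + e) y1);
    try lra; try (unfold in_rect; intros; lra).
  - rewrite !Cplus_0_l. apply Hsq; [lra|]. intros u Hu.
    pose proof (on_edge_not_off_lines _ _ _ _ u Hu). destruct Hu as [Hu _].
    apply Hcut; [unfold in_rect in *; lra|]. unfold off_lines in *; simpl in *; tauto.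
  all: intros q Hq; pose proof (proj1 (Hl q (or_intror Hq))); pose proof (Hoff q (or_intror Hq));
    unfold off_lines in *; simpl in *; tauto.
Qed.

Definition Clsum (F : C -> C) (l : list C) : C := fold_right (fun p s => F p + s)%C (RtoC 0) l.

Definition Clsum_poles (c : C -> C) (l : list C) (u : C) : C :=
  Clsum (fun p => c p * / (u - p))%C l.

Lemma is_Cderive_shift (p u : C) : is_Cderive (fun v => v - p)%C u 1.
Proof.
  eapply is_Cderive_eq.
  - apply is_Cderive_minus; [apply is_Cderive_id|apply is_Cderive_const].
  - ring.
Qed.

Lemma ex_Cderive_inv_shift (p u : C) : u <> p -> ex_Cderive (fun v => / (v - p))%C u.
Proof.
  intros Hu. eexists. apply (is_Cderive_comp Cinv).
  - now apply is_Cderive_inv, Cminus_eq_contra.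
  - apply is_Cderive_shift.
Qed.

Lemma ex_Cderive_pole (c p u : C) : u <> p -> ex_Cderive (fun v => c * / (v - p))%C u.
Proof.
  intros Hu. apply ex_Cderive_mult; [apply ex_Cderive_const|now apply ex_Cderive_inv_shift].
Qed.

Lemma ex_Cderive_Clsum_poles (c : C -> C) (l : list C) (u : C) :
  ~ In u l -> ex_Cderive (Clsum_poles c l) u.
Proof.
  induction l as [|p l IH]; intros Hu.
  - apply ex_Cderive_const.
  - apply ex_Cderive_plus.
    + apply ex_Cderive_pole. intros ->. apply Hu. now left.
    + apply IH. intros H. apply Hu. now right.
Qed.

Lemma is_residue_Clsum_poles (c : C -> C) (l : list C) (p : C) :
  NoDup l -> In p l -> is_residue (Clsum_poles c l) p (c p).
Proof.
  induction l as [|q l IH]; intros Hnd Hp; [destruct Hp|].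
  inversion Hnd as [|q' l' Hq Hl]; subst. destruct Hp as [->|Hp].
  - rewrite <- (Cplus_0_r (c p)). apply is_residue_plus; [apply is_residue_pole|].
    now apply is_residue_continuous, ex_Cderive_continuous, ex_Cderive_Clsum_poles.
  - rewrite <- (Cplus_0_l (c p)). apply is_residue_plus; [|now apply IH].
    apply is_residue_continuous, ex_Cderive_continuous, ex_Cderive_pole.
    intros ->. contradiction.
Qed.

(* The rotation by [c] moves the segment into the domain of [Clog]. *)
Lemma seg_int_pole (c p a b : C) : c <> RtoC 0 ->
  (forall t, 0 <= t <= 1 -> 0 < Re (c * (seg_point a b t - p))) ->
  seg_int (fun u => / (u - p))%C a b = (Clog (c * (b - p)) - Clog (c * (a - p)))%C.
Proof.
  intros Hc Hpos.
  assert (Hne : forall t, 0 <= t <= 1 -> (seg_point a b t - p)%C <> RtoC 0).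
  { intros t Ht E. specialize (Hpos t Ht). rewrite E, Cmult_0_r in Hpos. simpl in Hpos. lra. }
  apply is_seg_int_unique.
  apply (is_seg_int_primitive (fun u => Clog (c * (u - p)))); intros t Ht.
  - eapply is_Cderive_eq.
    + apply (is_Cderive_comp Clog); [apply is_Cderive_Clog; auto|].
      apply is_Cderive_scal, is_Cderive_shift.
    + field. auto.
  - apply ex_Cderive_continuous, ex_Cderive_inv_shift.
    intros E. apply (Hne t Ht). rewrite E. ring.
Qed.

Lemma oint_pole (p : C) (x0 x1 y0 y1 : R) : in_interior x0 x1 y0 y1 p ->
  oint (fun u => / (u - p))%C x0 x1 y0 y1 = (2 * RtoC PI * Ci)%C.
Proof.
  intros [Hx Hy]. unfold oint.
  rewrite (seg_int_pole Ci), (seg_int_pole 1), (seg_int_pole (- Ci)), (seg_int_pole (- RtoC 1));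
    try (rewrite <- ?RtoC_opp; apply RtoC_neq_0; lra);
    try (intros E; injection E; lra);
    try (intros t Ht; rewrite ?seg_point_h, ?seg_point_v; destruct p; simpl in *; nra).
  assert (Hturn : forall (c c' : C) (x y : R), c' = (- Ci * c)%C ->
            0 < Re (c * ((x, y) - p)) -> 0 < Im (c * ((x, y) - p)) ->
            Clog (c * ((x, y) - p)) = (Clog (c' * ((x, y) - p)) + RtoC (PI / 2) * Ci)%C).
  { intros c c' x y -> Hre Him. rewrite <- Cmult_assoc. now apply Clog_rotate. }
  rewrite (Hturn Ci 1 x1 y0), (Hturn 1 (- Ci) x1 y1)%C,
    (Hturn (- Ci) (- RtoC 1) x0 y1)%C, (Hturn (- RtoC 1) Ci x0 y0)%C;
    try (destruct p; simpl in *; lra);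
    try (unfold Ci, Cmult, Copp, RtoC; simpl; f_equal; ring).
  rewrite RtoC_div by lra. field.
Qed.

Lemma oint_Clsum_poles (c : C -> C) (l : list C) (x0 x1 y0 y1 : R) :
  x0 < x1 -> y0 < y1 -> (forall p, In p l -> in_interior x0 x1 y0 y1 p) ->
  oint (Clsum_poles c l) x0 x1 y0 y1 = (2 * RtoC PI * Ci * Clsum c l)%C.
Proof.
  intros Hx Hy. induction l as [|p l IH]; intros Hl.
  - rewrite (oint_primitive x0 x1 y0 y1) with (G := fun _ => RtoC 0); try lra.
    + simpl. ring.
    + intros u _. apply is_Cderive_const.
    + intros u _. apply Ccontinuous_const.
  - assert (Hedge : forall u, on_edge x0 x1 y0 y1 u -> ~ In u (p :: l)).
    { intros u [_ Hu] Hi. now apply Hu, Hl. }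
    assert (Hp : forall u, on_edge x0 x1 y0 y1 u -> u <> p).
    { intros u Hu ->. apply (Hedge p Hu). now left. }
    change (oint (fun u => c p * / (u - p) + Clsum_poles c l u)%C x0 x1 y0 y1
            = (2 * RtoC PI * Ci * (c p + Clsum c l))%C).
    rewrite oint_plus; try lra.
    + rewrite oint_scal, oint_pole, IH; try lra.
      * ring.
      * intros q Hq. apply Hl. now right.
      * apply Hl. now left.
      * intros u Hu. now apply ex_Cderive_continuous, ex_Cderive_inv_shift, Hp.
    + intros u Hu. now apply ex_Cderive_continuous, ex_Cderive_pole, Hp.
    + intros u Hu. apply ex_Cderive_continuous, ex_Cderive_Clsum_poles.
      intros Hi. apply (Hedge u Hu). now right.
Qed.

Lemma residue_theorem (g c : C -> C) (l : list C) (x0 x1 y0 y1 : R) :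
  x0 < x1 -> y0 < y1 -> NoDup l ->
  (forall u, in_rect x0 x1 y0 y1 u -> ~ In u l -> ex_Cderive g u) ->
  (forall p, In p l -> in_interior x0 x1 y0 y1 p /\ is_residue g p (c p)) ->
  oint g x0 x1 y0 y1 = (2 * RtoC PI * Ci * Clsum c l)%C.
Proof.
  intros Hx Hy Hnd Hg Hl.
  set (S := fun u => (- RtoC 1 * Clsum_poles c l u)%C).
  assert (HS : forall u, ~ In u l -> ex_Cderive S u).
  { intros u Hu. apply ex_Cderive_mult; [apply ex_Cderive_const|].
    now apply ex_Cderive_Clsum_poles. }
  assert (Hedge : forall u, on_edge x0 x1 y0 y1 u -> ~ In u l).
  { intros u [_ Hu] Hi. now apply Hu, Hl. }
  assert (Hzero : oint (fun u => g u + S u)%C x0 x1 y0 y1 = RtoC 0).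
  { apply oint_zero_residues with l; auto.
    - intros u Hu Hul. apply ex_Cderive_plus; auto.
    - intros p Hp. destruct (Hl p Hp) as [[Hpx Hpy] Hres]. split.
      + unfold off_lines; simpl. repeat split; lra.
      + replace (RtoC 0) with (c p + c p * - RtoC 1)%C by ring.
        apply is_residue_plus; [exact Hres|].
        apply is_residue_ext with (fun u => Clsum_poles c l u * - RtoC 1)%C.
        { intros u. unfold S. ring. }
        apply (is_residue_mult _ (fun _ => - RtoC 1)%C); [|apply Ccontinuous_const].
        now apply is_residue_Clsum_poles. }
  rewrite oint_plus in Hzero; try lra.
  - unfold S in Hzero. rewrite oint_scal, oint_Clsum_poles in Hzero; try lra.
    + rewrite <- (Cplus_0_r (2 * _ * _ * _)), <- Hzero. ring.
    + intros p Hp. now apply Hl.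
    + intros u Hu. now apply ex_Cderive_continuous, ex_Cderive_Clsum_poles, Hedge.
  - intros u Hu. apply ex_Cderive_continuous, Hg; [apply Hu|now apply Hedge].
  - intros u Hu. now apply ex_Cderive_continuous, HS, Hedge.
Qed.

(** * The complex sine and cotangent *)

Lemma Ci_sqr : (Ci * Ci)%C = (- RtoC 1)%C.
Proof. unfold Ci, Cmult, Copp, RtoC; simpl. f_equal; ring. Qed.

Lemma RtoC_PI_neq_0 : RtoC PI <> RtoC 0.
Proof. apply RtoC_neq_0, PI_neq0. Qed.

Lemma RtoC_2_neq_0 : RtoC 2 <> RtoC 0.
Proof. apply RtoC_neq_0. lra. Qed.

Lemma Cexp_opp_r (a : C) : (Cexp a * Cexp (- a))%C = RtoC 1.
Proof. rewrite <- Cexp_plus. replace (a + - a)%C with (RtoC 0) by ring. apply Cexp_0. Qed.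

Lemma is_Cderive_Cexp_scal (a w : C) :
  is_Cderive (fun v => Cexp (a * v)) w (a * Cexp (a * w)).
Proof.
  eapply is_Cderive_eq.
  - apply (is_Cderive_comp Cexp); [apply is_Cderive_Cexp|apply is_Cderive_scal, is_Cderive_id].
  - ring.
Qed.

Lemma is_Cderive_Csin (w : C) : is_Cderive Csin w (Ccos w).
Proof.
  apply is_Cderive_ext with (fun v => / (2 * Ci) * (Cexp (Ci * v) - Cexp (- Ci * v)))%C.
  - intros v. unfold Csin. replace (- (Ci * v))%C with (- Ci * v)%C by ring.
    field. auto using Ci_nz, RtoC_2_neq_0.
  - eapply is_Cderive_eq.
    + apply is_Cderive_scal, is_Cderive_minus; apply is_Cderive_Cexp_scal.
    + unfold Ccos. replace (- (Ci * w))%C with (- Ci * w)%C by ring.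
      field. auto using Ci_nz, RtoC_2_neq_0.
Qed.

Lemma ex_Cderive_Ccos (w : C) : ex_Cderive Ccos w.
Proof.
  eexists. apply is_Cderive_ext with (fun v => / 2 * (Cexp (Ci * v) + Cexp (- Ci * v)))%C.
  - intros v. unfold Ccos. replace (- (Ci * v))%C with (- Ci * v)%C by ring.
    field.
  - apply is_Cderive_scal, is_Cderive_plus; apply is_Cderive_Cexp_scal.
Qed.

Lemma Ccos2_Csin2 (w : C) : (Ccos w * Ccos w + Csin w * Csin w)%C = RtoC 1.
Proof.
  unfold Ccos, Csin. rewrite <- (Cexp_opp_r (Ci * w)).
  set (X := Cexp (Ci * w)). set (Y := Cexp (- (Ci * w))).
  replace ((X - Y) / (2 * Ci) * ((X - Y) / (2 * Ci)))%C
    with ((X - Y) * (X - Y) / (2 * 2 * (Ci * Ci)))%C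
    by (field; auto using Ci_nz, RtoC_2_neq_0).
  rewrite Ci_sqr. field.
Qed.

Lemma Csin_opp (w : C) : Csin (- w) = (- Csin w)%C.
Proof.
  unfold Csin. replace (Ci * - w)%C with (- (Ci * w))%C by ring.
  replace (- - (Ci * w))%C with (Ci * w)%C by ring. unfold Cdiv. ring.
Qed.

Lemma Ccos_opp (w : C) : Ccos (- w) = Ccos w.
Proof.
  unfold Ccos. replace (Ci * - w)%C with (- (Ci * w))%C by ring.
  replace (- - (Ci * w))%C with (Ci * w)%C by ring. unfold Cdiv. ring.
Qed.

Lemma Cexp_Ci_mult_RtoC (x : R) : Cexp (Ci * RtoC x) = (cos x, sin x).
Proof.
  replace (Ci * RtoC x)%C with ((0, x) : C) by (unfold Ci, Cmult, RtoC; simpl; f_equal; ring).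
  unfold Cexp; simpl. rewrite exp_0. f_equal; ring.
Qed.

Lemma Csin_RtoC (x : R) : Csin (RtoC x) = RtoC (sin x).
Proof.
  unfold Csin. replace (- (Ci * RtoC x))%C with (Ci * RtoC (- x))%C by (rewrite RtoC_opp; ring).
  rewrite !Cexp_Ci_mult_RtoC, cos_neg, sin_neg.
  replace ((cos x, sin x) - (cos x, (- sin x)%R))%C with (RtoC (sin x) * (2 * Ci))%C
    by (unfold Ci, Cminus, Cplus, Copp, Cmult, RtoC; simpl; f_equal; ring).
  field. auto using Ci_nz, RtoC_2_neq_0.
Qed.

Lemma Csin_eq_0 (w : C) : Csin w = RtoC 0 -> exists k : Z, w = RtoC (IZR k * PI).
Proof.
  intros H. destruct w as [a b].
  assert (E : Cexp (Ci * (a, b)) = Cexp (- (Ci * (a, b)))).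
  { unfold Csin in H. set (X := Cexp (Ci * (a, b))) in *. set (Y := Cexp (- (Ci * (a, b)))) in *.
    replace X with ((X - Y) / (2 * Ci) * (2 * Ci) + Y)%C
      by (field; auto using Ci_nz, RtoC_2_neq_0).
    rewrite H. ring. }
  assert (Hb : b = 0).
  { apply (f_equal Cmod) in E. rewrite !Cmod_Cexp in E. apply exp_inv in E. simpl in E. lra. }
  subst b. change ((a, 0) : C) with (RtoC a) in *. rewrite Csin_RtoC in H.
  apply RtoC_inj, sin_eq_0_0 in H. destruct H as [k ->]. now exists k.
Qed.

Lemma Cmod_Csin_ge (v : C) : exp (Im v) - exp (- Im v) <= 2 * Cmod (Csin v).
Proof.
  unfold Csin. rewrite Cmod_div by (apply Cmult_neq_0; auto using Ci_nz, RtoC_2_neq_0).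
  rewrite Cmod_mult, Cmod_Ci, Cmod_R, Rabs_pos_eq by lra.
  pose proof (Cmod_triangle_inv (Cexp (- (Ci * v))) (Cexp (Ci * v))) as H.
  rewrite Cmod_minus_sym, !Cmod_Cexp in H.
  replace (Re (- (Ci * v))) with (Im v) in H by (destruct v; simpl; ring).
  replace (Re (Ci * v)) with (- Im v) in H by (destruct v; simpl; ring).
  field_simplify (2 * (Cmod (Cexp (Ci * v) - Cexp (- (Ci * v))) / (2 * 1))). lra.
Qed.

(* [cot v + i] is [exp (i v) / sin v]. *)
Lemma Cmod_Ccot_plus_Ci_le (v : C) : 1 <= 2 * Im v ->
  Cmod (Ccot v + Ci) <= 4 * exp (- (2 * Im v)).
Proof.
  intros Hv. pose proof (Cmod_Csin_ge v) as Hsin. set (y := Im v) in *.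
  assert (Hx : exp (- (2 * y)) <= 1 / 2).
  { rewrite exp_Ropp. pose proof (exp_ineq1_le (2 * y)).
    replace (1 / 2) with (/ 2) by field. apply Rinv_le_contravar; lra. }
  assert (Hexp : exp (- y) = exp y * exp (- (2 * y))) by (rewrite <- exp_plus; f_equal; ring).
  pose proof (exp_pos y) as Hy. pose proof (exp_pos (- (2 * y))) as Hy2.
  assert (Hlow : exp y / 4 <= Cmod (Csin v)) by nra.
  assert (Hsin0 : Csin v <> RtoC 0) by (apply Cmod_gt_0; lra).
  replace (Ccot v + Ci)%C with (Cexp (Ci * v) / Csin v)%C.
  - rewrite Cmod_div, Cmod_Cexp by exact Hsin0.
    replace (Re (Ci * v)) with (- y) by (unfold y; destruct v; simpl; ring).
    rewrite Hexp. apply Rle_div_l; [lra|]. nra.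
  - unfold Ccot. transitivity ((Ccos v + Ci * Csin v) / Csin v)%C; [|field; exact Hsin0].
    f_equal. unfold Ccos, Csin. field. auto using Ci_nz, RtoC_2_neq_0.
Qed.

Lemma Csin_neq_0 (v : C) : Im v <> 0 -> Csin v <> RtoC 0.
Proof.
  intros Hv H. destruct (Csin_eq_0 v H) as [k ->]. apply Hv. reflexivity.
Qed.

Lemma Cmod_Ccot_minus_Ci_le (v : C) : 1 <= - (2 * Im v) ->
  Cmod (Ccot v - Ci) <= 4 * exp (2 * Im v).
Proof.
  intros Hv. assert (Hsin : Csin v <> RtoC 0) by (apply Csin_neq_0; lra).
  replace (Ccot v - Ci)%C with (- (Ccot (- v) + Ci))%C.
  - rewrite Cmod_opp. replace (2 * Im v) with (- (2 * Im (- v))) by (destruct v; simpl; ring).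
    apply Cmod_Ccot_plus_Ci_le. destruct v; simpl in *; lra.
  - unfold Ccot. rewrite Ccos_opp, Csin_opp. field. exact Hsin.
Qed.

(** * Contour integrals against [delta] *)

Lemma hh_pos (beta : R) : beta < 2 -> 0 < hh beta.
Proof. intros H. unfold hh. pose proof PI_RGT_0. apply Rmult_lt_0_compat; nra. Qed.

Definition phase (beta : R) (u : C) : C := (RtoC PI * u / RtoC (hh beta))%C.

Definition node (beta : R) (j : nat) : C := RtoC (INR j * hh beta).

Lemma Im_phase (beta : R) (u : C) : beta < 2 -> Im (phase beta u) = PI * Im u / hh beta.
Proof.
  intros H. pose proof (hh_pos beta H). unfold phase, Cdiv. rewrite <- RtoC_inv by lra.
  destruct u. simpl. field. lra.
Qed.

Lemma is_Cderive_phase (beta : R) (u : C) :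
  is_Cderive (phase beta) u (RtoC PI / RtoC (hh beta)).
Proof.
  apply is_Cderive_ext with (fun v => RtoC PI / RtoC (hh beta) * v)%C.
  - intros v. unfold phase, Cdiv. ring.
  - eapply is_Cderive_eq; [apply is_Cderive_scal, is_Cderive_id|ring].
Qed.

Lemma Csin_phase_node (beta : R) (j : nat) : beta < 2 -> Csin (phase beta (node beta j)) = RtoC 0.
Proof.
  intros Hb. pose proof (hh_pos beta Hb).
  assert (E : phase beta (node beta j) = RtoC (IZR (Z.of_nat j) * PI)).
  { unfold phase, node. rewrite <- INR_IZR_INZ, <- RtoC_mult, <- RtoC_div by lra.
    f_equal. field. lra. }
  rewrite E, Csin_RtoC. f_equal. apply sin_eq_0_1. now exists (Z.of_nat j).
Qed.

Lemma Csin_phase_eq_0 (beta : R) (n : nat) (u : C) : beta < 2 ->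
  0 < Re u < INR (S n) * hh beta -> Csin (phase beta u) = RtoC 0 ->
  exists j, (1 <= j <= n)%nat /\ u = node beta j.
Proof.
  intros Hb Hu H. pose proof (hh_pos beta Hb) as Hh. pose proof PI_RGT_0 as Hpi.
  destruct (Csin_eq_0 _ H) as [k Hk].
  assert (E : u = RtoC (IZR k * hh beta)).
  { replace u with (phase beta u * (RtoC (hh beta) / RtoC PI))%C
      by (unfold phase; field; split; apply RtoC_neq_0; lra).
    rewrite Hk, <- RtoC_div, <- RtoC_mult by lra. f_equal. field. lra. }
  rewrite E in Hu. simpl Re in Hu.
  assert (Hk0 : (0 < k)%Z) by (apply lt_IZR, Rmult_lt_reg_r with (hh beta); lra).
  assert (Hkn : (k < Z.of_nat (S n))%Z).
  { apply lt_IZR. rewrite <- INR_IZR_INZ. apply Rmult_lt_reg_r with (hh beta); lra. }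
  exists (Z.to_nat k). split; [lia|].
  unfold node. now rewrite INR_IZR_INZ, Z2Nat.id by lia.
Qed.

Lemma ex_Cderive_m_cot (beta : R) (u : C) :
  Csin (phase beta u) <> RtoC 0 -> ex_Cderive (m_cot beta) u.
Proof.
  intros H. apply ex_Cderive_mult; [apply ex_Cderive_const|].
  assert (Hphase : ex_Cderive (phase beta) u) by (eexists; apply is_Cderive_phase).
  apply (ex_Cderive_div (fun v => Ccos (phase beta v)) (fun v => Csin (phase beta v))).
  - apply (ex_Cderive_comp Ccos); [apply ex_Cderive_Ccos|exact Hphase].
  - apply (ex_Cderive_comp Csin); [eexists; apply is_Cderive_Csin|exact Hphase].
  - exact H.
Qed.

Lemma is_residue_m_cot (beta : R) (j : nat) : beta < 2 ->
  is_residue (m_cot beta) (node beta j) (RtoC (hh beta) / (2 * RtoC PI * Ci)).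
Proof.
  intros Hb. pose proof (hh_pos beta Hb). pose proof PI_RGT_0. set (p := node beta j).
  pose proof (Csin_phase_node beta j Hb) as Hsin. fold p in Hsin.
  pose proof RtoC_PI_neq_0 as HpiC.
  assert (HhC : RtoC (hh beta) <> RtoC 0) by (apply RtoC_neq_0; lra).
  assert (Hcos : Ccos (phase beta p) <> RtoC 0).
  { intros E. pose proof (Ccos2_Csin2 (phase beta p)) as Hsum. rewrite E, Hsin in Hsum.
    apply (f_equal Re) in Hsum. simpl in Hsum. lra. }
  set (A := fun u => (- (Ci / 2) * Ccos (phase beta u))%C).
  set (B := fun u => Csin (phase beta u)).
  set (b := (Ccos (phase beta p) * (RtoC PI / RtoC (hh beta)))%C).
  assert (Hb0 : b <> RtoC 0).
  { unfold b. rewrite <- RtoC_div by lra. apply Cmult_neq_0; [exact Hcos|].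
    apply RtoC_neq_0. apply Rgt_not_eq, Rdiv_lt_0_compat; lra. }
  apply is_residue_ext with (fun u => A u / B u)%C.
  { intros u. unfold A, B, m_cot, Ccot, phase, Cdiv. ring. }
  replace (RtoC (hh beta) / (2 * RtoC PI * Ci))%C with (A p / b)%C.
  - apply is_residue_div; [|apply (is_Cderive_comp Csin (phase beta))|exact Hsin|exact Hb0].
    + apply ex_Cderive_continuous, ex_Cderive_mult; [apply ex_Cderive_const|].
      apply (ex_Cderive_comp Ccos); [apply ex_Cderive_Ccos|].
      eexists; apply is_Cderive_phase.
    + apply is_Cderive_Csin.
    + apply is_Cderive_phase.
  - unfold A, b.
    transitivity (- (Ci * Ci) * RtoC (hh beta) / (2 * RtoC PI * Ci))%C.
    + field. repeat split; auto using Ci_nz, RtoC_2_neq_0.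
    + rewrite Ci_sqr. field. repeat split; auto using Ci_nz, RtoC_2_neq_0.
Qed.

Lemma Cmod_delta_le (beta : R) (u : C) : beta < 2 ->
  1 <= 2 * (PI * Rabs (Im u) / hh beta) ->
  Cmod (delta beta u) <= 2 * exp (- (2 * (PI * Rabs (Im u) / hh beta))).
Proof.
  intros Hb Hu. pose proof (Im_phase beta u Hb) as Hphase.
  assert (HCi2 : forall w e, Cmod w <= 4 * e -> Cmod (Ci / 2 * w) <= 2 * e).
  { intros w e Hw. rewrite Cmod_mult, Cmod_div, Cmod_Ci, Cmod_R, Rabs_pos_eq
      by (lra || apply RtoC_2_neq_0). lra. }
  assert (Hhalf : (Ci / 2 * Ci)%C = (- / 2)%C).
  { transitivity (Ci * Ci / 2)%C; [field|rewrite Ci_sqr; field]. }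
  unfold delta, mu, m_cot. fold (phase beta u). destruct (Rle_dec 0 (Im u)) as [Hi|Hi].
  - rewrite Rabs_pos_eq, <- Hphase in * by exact Hi.
    replace (RtoC (-1 / 2) - - (Ci / 2) * Ccot (phase beta u))%C
      with (Ci / 2 * (Ccot (phase beta u) + Ci))%C.
    + now apply HCi2, Cmod_Ccot_plus_Ci_le.
    + replace (RtoC (-1 / 2)) with (- / 2)%C
        by (rewrite <- RtoC_inv, <- RtoC_opp by lra; f_equal; field).
      rewrite <- Hhalf. ring.
  - rewrite Rabs_left in * by lra.
    replace (2 * (PI * - Im u / hh beta)) with (- (2 * Im (phase beta u))) in *
      by (rewrite Hphase; field; apply Rgt_not_eq, hh_pos, Hb).
    rewrite Ropp_involutive.
    replace (RtoC (1 / 2) - - (Ci / 2) * Ccot (phase beta u))%C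
      with (Ci / 2 * (Ccot (phase beta u) - Ci))%C.
    + now apply HCi2, Cmod_Ccot_minus_Ci_le.
    + replace (RtoC (1 / 2)) with (- - / 2)%C
        by (rewrite <- RtoC_inv, <- !RtoC_opp by lra; f_equal; field).
      rewrite <- Hhalf. ring.
Qed.

Lemma is_seg_int_affine (c : C) (f k g : C -> C) (p q : C) :
  (forall t, 0 < t < 1 -> g (seg_point p q t) = c * f (seg_point p q t) + k (seg_point p q t))%C ->
  ex_seg_int f p q -> ex_seg_int k p q ->
  is_seg_int g p q (c * seg_int f p q + seg_int k p q)%C.
Proof.
  intros Hg Hf Hk. apply is_seg_int_ext with (fun u => c * f u + k u)%C.
  - intros t Ht. symmetry. auto.
  - apply is_seg_int_plus; [apply is_seg_int_scal|]; now apply seg_int_correct.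
Qed.

Lemma rect_int_oint (g : C -> C) (x0 x1 a : R) :
  ex_seg_int g (x0, a) (x1, a) -> ex_seg_int g (x0, - a) (x0, a) ->
  rect_int g x0 x1 a = oint g x0 x1 (- a) a.
Proof.
  intros Htop Hleft. unfold rect_int, oint.
  rewrite (seg_int_reverse g (x0, a) (x1, a)), (seg_int_reverse g (x0, - a) (x0, a)) by auto.
  ring.
Qed.

Lemma rect_int_jump (f k g : C -> C) (cu cl : C) (x0 x1 a : R) : x0 < x1 -> 0 < a ->
  (forall u, on_edge x0 x1 (- a) a u -> Ccontinuous f u) ->
  (forall u, on_edge x0 x1 (- a) a u -> Ccontinuous k u) ->
  (forall u, 0 < Im u -> g u = (cu * f u + k u)%C) ->
  (forall u, Im u < 0 -> g u = (cl * f u + k u)%C) ->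
  rect_int g x0 x1 a =
    (cu * oint f x0 x1 0 a + cl * oint f x0 x1 (- a) 0
     + (cl - cu) * seg_int f (RtoC x0) (RtoC x1) + oint k x0 x1 (- a) a)%C.
Proof.
  intros Hx Ha Hf Hk Hupper Hlower.
  assert (Hbot : is_seg_int g (x0, - a) (x1, - a)
            (cl * seg_int f (x0, (- a)%R) (x1, (- a)%R) + seg_int k (x0, (- a)%R) (x1, (- a)%R))%C).
  { apply is_seg_int_affine; [|apply (ex_seg_int_edge_h x0 x1 (- a) a); auto; lra..].
    intros t Ht. rewrite seg_point_h. apply Hlower. simpl. lra. }
  assert (Htop : is_seg_int g (x0, a) (x1, a)
            (cu * seg_int f (x0, a) (x1, a) + seg_int k (x0, a) (x1, a))%C).
  { apply is_seg_int_affine; [|apply (ex_seg_int_edge_h x0 x1 (- a) a); auto; lra..].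
    intros t Ht. rewrite seg_point_h. apply Hupper. simpl. lra. }
  assert (Hside : forall x, x = x0 \/ x = x1 -> is_seg_int g (x, - a) (x, a)
            (cl * seg_int f (x, (- a)%R) (x, 0%R) + seg_int k (x, (- a)%R) (x, 0%R)
             + (cu * seg_int f (x, 0%R) (x, a) + seg_int k (x, 0%R) (x, a)))%C).
  { intros x Hx'. apply is_seg_int_Chasles with (/ 2); [lra| |];
      rewrite seg_point_v; replace (- a + / 2 * (a - - a)) with 0 by field;
      (apply is_seg_int_affine; [|apply (ex_seg_int_edge_v x0 x1 (- a) a); auto; lra..]);
      intros t Ht; rewrite seg_point_v; (apply Hlower + apply Hupper); simpl; nra. }
  pose proof (Hside x0 (or_introl eq_refl)) as Hleft.
  pose proof (Hside x1 (or_intror eq_refl)) as Hright.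
  rewrite rect_int_oint by (eexists; eassumption). unfold oint.
  rewrite (is_seg_int_unique _ _ _ _ Hbot), (is_seg_int_unique _ _ _ _ Htop),
    (is_seg_int_unique _ _ _ _ Hleft), (is_seg_int_unique _ _ _ _ Hright).
  rewrite (seg_int_Chasles_v k x0 (- a) 0 a), (seg_int_Chasles_v k x1 (- a) 0 a)
    by (lra || (apply (ex_seg_int_edge_v x0 x1 (- a) a); auto; lra)).
  unfold RtoC. ring.
Qed.

Lemma Clsum_app (F : C -> C) (l m : list C) : Clsum F (l ++ m) = (Clsum F l + Clsum F m)%C.
Proof. induction l as [|p l IH]; simpl; [ring|rewrite IH; ring]. Qed.

Lemma Clsum_ext (F G : C -> C) (l : list C) :
  (forall p, In p l -> F p = G p) -> Clsum F l = Clsum G l.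
Proof.
  induction l as [|p l IH]; intros H; simpl; [reflexivity|].
  rewrite (H p (or_introl eq_refl)), IH; [reflexivity|]. intros q Hq. apply H. now right.
Qed.

Lemma Clsum_scal (c : C) (F : C -> C) (l : list C) :
  Clsum (fun p => c * F p)%C l = (c * Clsum F l)%C.
Proof. induction l as [|p l IH]; simpl; [ring|rewrite IH; ring]. Qed.

Lemma Clsum_minus (F G : C -> C) (l : list C) :
  Clsum (fun p => F p - G p)%C l = (Clsum F l - Clsum G l)%C.
Proof. induction l as [|p l IH]; simpl; [ring|rewrite IH; ring]. Qed.

Lemma Clsum_map_seq (F : C -> C) (p : nat -> C) (n : nat) :
  Clsum F (map p (seq 1 n)) = csum (fun j => F (p j)) n.
Proof.
  induction n as [|n IH]; [reflexivity|].
  rewrite seq_S, map_app, Clsum_app, IH. simpl. ring.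
Qed.

Lemma NoDup_nodes (beta : R) (n : nat) : beta < 2 -> NoDup (map (node beta) (seq 1 n)).
Proof.
  intros Hb. pose proof (hh_pos beta Hb).
  apply Injective_map_NoDup; [|apply seq_NoDup]. intros i j E. apply RtoC_inj in E.
  apply INR_eq. now apply Rmult_eq_reg_r with (hh beta); [|lra].
Qed.

Section DeltaContour.
Variables (beta : R) (f c : C -> C) (x0 x1 a : R) (n : nat) (lu ll : list C).
Hypothesis Hbeta : beta < 2.
Hypothesis Ha : 0 < a.
Hypothesis Hx0 : 0 < x0 < hh beta.
Hypothesis Hx1 : INR n * hh beta < x1 < INR (S n) * hh beta.
Hypothesis Hx : x0 < x1.
Hypothesis HNoDup : NoDup (lu ++ ll).
Hypothesis Hf : forall u, in_rect x0 x1 (- a) a u -> ~ In u (lu ++ ll) -> ex_Cderive f u.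
Hypothesis Hlu : forall p, In p lu -> in_interior x0 x1 0 a p /\ is_residue f p (c p).
Hypothesis Hll : forall p, In p ll -> in_interior x0 x1 (- a) 0 p /\ is_residue f p (c p).

Let nodes := map (node beta) (seq 1 n).

Lemma poles_interior (p : C) : In p (lu ++ ll) ->
  in_interior x0 x1 (- a) a p /\ Im p <> 0 /\ is_residue f p (c p).
Proof.
  intros Hp. apply in_app_or in Hp. unfold in_interior.
  destruct Hp as [Hp|Hp]; [destruct (Hlu p Hp) as [Hi Hres]|destruct (Hll p Hp) as [Hi Hres]];
    unfold in_interior in Hi; repeat split; auto; lra.
Qed.

Lemma nodes_interior (p : C) : In p nodes ->
  exists j, p = node beta j /\ in_interior x0 x1 (- a) a p /\ Im p = 0.
Proof.
  intros Hp. apply in_map_iff in Hp. destruct Hp as [j [<- Hj]]. apply in_seq in Hj.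
  pose proof (hh_pos beta Hbeta) as Hh.
  assert (Hj1 : 1 <= INR j) by (apply (le_INR 1); lia).
  assert (Hjn : INR j <= INR n) by (apply le_INR; lia).
  exists j. unfold in_interior; simpl. repeat split; auto; nra.
Qed.

Lemma Csin_phase_off_nodes (u : C) : in_rect x0 x1 (- a) a u -> ~ In u nodes ->
  Csin (phase beta u) <> RtoC 0.
Proof.
  intros [[Hu0 Hu1] _] Hn H.
  destruct (Csin_phase_eq_0 beta n u Hbeta ltac:(lra) H) as [j [Hj ->]].
  apply Hn, in_map, in_seq. lia.
Qed.

Lemma node_not_pole (p : C) : In p nodes -> ~ In p (lu ++ ll).
Proof.
  intros Hp Hp'. destruct (nodes_interior p Hp) as [_ [_ [_ Him]]].
  now apply (poles_interior p Hp').
Qed.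

Lemma oint_mult_m_cot :
  oint (fun u => f u * m_cot beta u)%C x0 x1 (- a) a
    = (2 * RtoC PI * Ci * Clsum (fun p => c p * m_cot beta p) (lu ++ ll)
       + RtoC (hh beta) * csum (fun j => f (node beta j)) n)%C.
Proof.
  set (rho := (RtoC (hh beta) / (2 * RtoC PI * Ci))%C).
  set (res := fun p => if Req_EM_T (Im p) 0 then (rho * f p)%C else (c p * m_cot beta p)%C).
  assert (Hpole : forall p, In p (lu ++ ll) -> res p = (c p * m_cot beta p)%C).
  { intros p Hp. destruct (poles_interior p Hp) as [_ [Him _]].
    unfold res. now destruct (Req_EM_T (Im p) 0). }
  assert (Hnode : forall p, In p nodes -> res p = (rho * f p)%C).
  { intros p Hp. destruct (nodes_interior p Hp) as [_ [_ [_ Him]]].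
    unfold res. now destruct (Req_EM_T (Im p) 0). }
  rewrite (residue_theorem _ res ((lu ++ ll) ++ nodes)).
  - rewrite Clsum_app, (Clsum_ext _ _ _ Hpole), (Clsum_ext _ _ _ Hnode), Clsum_scal.
    unfold nodes. rewrite Clsum_map_seq. unfold rho. field.
    auto using Ci_nz, RtoC_2_neq_0, RtoC_PI_neq_0.
  - exact Hx.
  - lra.
  - apply NoDup_app; auto; [apply NoDup_nodes, Hbeta|].
    intros p Hp Hn. now apply (node_not_pole p Hn).
  - intros u Hu Hn. apply ex_Cderive_mult.
    + apply Hf; [exact Hu|]. intros Hi. apply Hn, in_or_app. now left.
    + apply ex_Cderive_m_cot, Csin_phase_off_nodes; [exact Hu|].
      intros Hi. apply Hn, in_or_app. now right.
  - intros p Hp. apply in_app_or in Hp. destruct Hp as [Hp|Hp].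
    + destruct (poles_interior p Hp) as [Hi [Him Hres]]. split; [exact Hi|].
      rewrite Hpole by exact Hp. apply is_residue_mult; [exact Hres|].
      apply ex_Cderive_continuous, ex_Cderive_m_cot, Csin_phase_off_nodes.
      * unfold in_rect, in_interior in *. lra.
      * intros Hn. now destruct (nodes_interior p Hn) as [_ [_ [_ Him_zero]]].
    + destruct (nodes_interior p Hp) as [j [Ej [Hi Him]]]. split; [exact Hi|].
      rewrite Hnode by exact Hp.
      apply is_residue_ext with (fun u => m_cot beta u * f u)%C; [intros u; ring|].
      apply is_residue_mult; [rewrite Ej; now apply is_residue_m_cot|].
      apply ex_Cderive_continuous, Hf; [unfold in_rect, in_interior in *; lra|].
      now apply node_not_pole.
Qed.

Lemma Clsum_delta :
  Clsum (fun p => c p * delta beta p)%C (lu ++ ll)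
    = (RtoC (-1 / 2) * Clsum c lu + RtoC (1 / 2) * Clsum c ll
       - Clsum (fun p => c p * m_cot beta p) (lu ++ ll))%C.
Proof.
  assert (Hu : forall p, In p lu ->
            (c p * delta beta p = RtoC (-1 / 2) * c p - c p * m_cot beta p)%C).
  { intros p Hp. destruct (Hlu p Hp) as [[_ Hi] _]. unfold delta, mu.
    destruct (Rle_dec 0 (Im p)); [ring|lra]. }
  assert (Hl : forall p, In p ll ->
            (c p * delta beta p = RtoC (1 / 2) * c p - c p * m_cot beta p)%C).
  { intros p Hp. destruct (Hll p Hp) as [[_ Hi] _]. unfold delta, mu.
    destruct (Rle_dec 0 (Im p)); [lra|ring]. }
  rewrite !Clsum_app, (Clsum_ext _ _ _ Hu), (Clsum_ext _ _ _ Hl), !Clsum_minus, !Clsum_scal.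
  ring.
Qed.

Lemma oint_upper_half : oint f x0 x1 0 a = (2 * RtoC PI * Ci * Clsum c lu)%C.
Proof.
  apply residue_theorem; auto; [now apply NoDup_app_remove_r in HNoDup|].
  intros u [Hux Huy] Hn. apply Hf; [unfold in_rect; lra|]. intros Hi.
  apply in_app_or in Hi. destruct Hi as [Hi|Hi]; [contradiction|].
  destruct (Hll u Hi) as [[_ Him] _]. lra.
Qed.

Lemma oint_lower_half : oint f x0 x1 (- a) 0 = (2 * RtoC PI * Ci * Clsum c ll)%C.
Proof.
  apply residue_theorem; auto; [lra|now apply NoDup_app_remove_l in HNoDup|].
  intros u [Hux Huy] Hn. apply Hf; [unfold in_rect; lra|]. intros Hi.
  apply in_app_or in Hi. destruct Hi as [Hi|Hi]; [|contradiction].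
  destruct (Hlu u Hi) as [[_ Him] _]. lra.
Qed.

Lemma delta_contour_integral :
  rect_int (fun u => f u * delta beta u)%C x0 x1 a
    = (seg_int f (RtoC x0) (RtoC x1) - RtoC (hh beta) * csum (fun j => f (node beta j)) n
       + 2 * RtoC PI * Ci * Clsum (fun p => c p * delta beta p) (lu ++ ll))%C.
Proof.
  assert (Hedge : forall u, on_edge x0 x1 (- a) a u ->
            ex_Cderive f u /\ ex_Cderive (fun v => f v * m_cot beta v)%C u).
  { intros u [Hu Hn].
    assert (Hfu : ex_Cderive f u).
    { apply Hf; [exact Hu|]. intros Hi. now apply Hn, poles_interior. }
    split; [exact Hfu|]. apply ex_Cderive_mult; [exact Hfu|].
    apply ex_Cderive_m_cot, Csin_phase_off_nodes; [exact Hu|]. intros Hi.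
    now destruct (nodes_interior u Hi) as [j [_ [Hint _]]]. }
  rewrite (rect_int_jump f (fun u => - RtoC 1 * (f u * m_cot beta u))%C _
             (RtoC (-1 / 2)) (RtoC (1 / 2))); auto.
  - rewrite oint_scal, oint_mult_m_cot, oint_upper_half, oint_lower_half, Clsum_delta; try lra.
    + replace (RtoC (1 / 2) - RtoC (-1 / 2))%C with (RtoC 1)
        by (rewrite <- RtoC_minus; f_equal; field).
      ring.
    + intros u Hu. now apply ex_Cderive_continuous, Hedge.
  - intros u Hu. now apply ex_Cderive_continuous, Hedge.
  - intros u Hu. apply ex_Cderive_continuous, ex_Cderive_mult; [apply ex_Cderive_const|].
    now apply Hedge.
  - intros u Hu. unfold delta, mu. destruct (Rle_dec 0 (Im u)); [ring|lra].
  - intros u Hu. unfold delta, mu. destruct (Rle_dec 0 (Im u)); [lra|ring].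
Qed.

End DeltaContour.

(** * The quadrature error as a contour integral *)

Lemma Cexp_double (w : C) : Cexp (2 * w) = (Cexp w * Cexp w)%C.
Proof. rewrite <- Cexp_plus. f_equal. ring. Qed.

Lemma Cexp_double_plus_eq_0 (a b : C) : (Cexp (2 * a) + Cexp (2 * b))%C = RtoC 0 ->
  exists k : Z, a = (b + (0, (IZR k * PI + PI / 2)%R))%C.
Proof.
  intros H. set (d := (a - b)%C).
  assert (Hd : Cexp (2 * d) = (- RtoC 1)%C).
  { unfold d. replace (2 * (a - b))%C with (2 * a + - (2 * b))%C by ring. rewrite Cexp_plus.
    replace (Cexp (2 * a)) with (- Cexp (2 * b))%C
      by (rewrite <- (Cplus_0_r (- _)), <- H; ring).
    rewrite <- (Cexp_opp_r (2 * b)). ring. }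
  assert (Hre : Re d = 0).
  { pose proof (f_equal Cmod Hd) as Hm. rewrite Cmod_Cexp, Cmod_opp, Cmod_1, <- exp_0 in Hm.
    apply exp_inv in Hm. destruct d; simpl in *; lra. }
  assert (Hcos : cos (Im d) = 0).
  { apply (f_equal Re) in Hd. destruct d as [x y]. simpl in Hre, Hd |- *. subst x.
    replace (2 * 0 - 0 * y) with 0 in Hd by ring.
    replace (2 * y + 0 * 0) with (2 * y) in Hd by ring.
    rewrite exp_0, cos_2a_cos in Hd. nra. }
  destruct (cos_eq_0_0 _ Hcos) as [k Hk]. exists k. rewrite <- Hk, <- Hre.
  unfold d. destruct a, b. unfold Cplus; simpl. f_equal; ring.
Qed.

Lemma PI_lt_17_5 : PI < 17 / 5.
Proof.
  pose proof (PI_ineq 2) as [_ H]. unfold tg_alt, PI_tg in H. simpl in H. lra.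
Qed.

Lemma four_TT_sqr (beta : R) (Nt : nat) : beta < 2 -> 4 * TT beta Nt ^ 2 = INR Nt * hh beta.
Proof.
  intros H. pose proof (hh_pos beta H). pose proof (pos_INR Nt).
  unfold TT. rewrite <- Rsqr_pow2, Rsqr_sqrt by nra. field.
Qed.

Definition f_num (beta : R) (Nt : nat) (z u : C) : C :=
  (z / RtoC PI * / Csqrt u * Cexp (Csqrt u - RtoC (TT beta Nt)))%C.

Definition f_den (beta : R) (Nt : nat) (z u : C) : C :=
  (Cexp (2 * (Csqrt u - RtoC (TT beta Nt))) + z)%C.

Lemma is_Cderive_Csqrt_shift (T : R) (u : C) : 0 < Re u ->
  is_Cderive (fun v => Csqrt v - RtoC T)%C u (/ (2 * Csqrt u)).
Proof.
  intros Hu. eapply is_Cderive_eq.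
  - apply is_Cderive_minus; [now apply is_Cderive_Csqrt|apply is_Cderive_const].
  - ring.
Qed.

Lemma is_Cderive_f_den (beta : R) (Nt : nat) (z u : C) : 0 < Re u ->
  is_Cderive (f_den beta Nt z) u (Cexp (2 * (Csqrt u - RtoC (TT beta Nt))) / Csqrt u).
Proof.
  intros Hu. eapply is_Cderive_eq.
  - apply is_Cderive_plus; [|apply is_Cderive_const].
    apply (is_Cderive_comp Cexp); [apply is_Cderive_Cexp|].
    now apply is_Cderive_scal, is_Cderive_Csqrt_shift.
  - field. now apply Csqrt_neq_0.
Qed.

Lemma ex_Cderive_f_num (beta : R) (Nt : nat) (z u : C) : 0 < Re u ->
  ex_Cderive (f_num beta Nt z) u.
Proof.
  intros Hu. apply ex_Cderive_mult.
  - apply ex_Cderive_mult; [apply ex_Cderive_const|].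
    apply (ex_Cderive_comp Cinv).
    + eexists. now apply is_Cderive_inv, Csqrt_neq_0.
    + eexists. now apply is_Cderive_Csqrt.
  - apply (ex_Cderive_comp Cexp); eexists; [apply is_Cderive_Cexp|].
    now apply is_Cderive_Csqrt_shift.
Qed.

Lemma ex_Cderive_f_uz (beta : R) (Nt : nat) (z u : C) : 0 < Re u ->
  f_den beta Nt z u <> RtoC 0 -> ex_Cderive (fun v => f_uz beta Nt v z) u.
Proof.
  intros Hu Hden. apply (ex_Cderive_div (f_num beta Nt z) (f_den beta Nt z)).
  - now apply ex_Cderive_f_num.
  - eexists. now apply is_Cderive_f_den.
  - exact Hden.
Qed.

Lemma r_t_csum (beta : R) (Nt : nat) (z : C) : beta < 2 ->
  r_t beta Nt z = (RtoC (hh beta) * csum (fun j => f_uz beta Nt (node beta j) z) Nt)%C.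
Proof.
  intros Hb. pose proof (hh_pos beta Hb).
  unfold r_t. set (F := fun j : nat => _).
  assert (HF : forall n, (z * RtoC (hh beta) / RtoC PI * csum F n
            = RtoC (hh beta) * csum (fun j => f_uz beta Nt (node beta j) z) n)%C).
  2: apply HF.
  induction n as [|n IH]; [simpl; ring|]. cbn [csum].
  rewrite !Cmult_plus_distr_l, IH. f_equal. unfold F, f_uz, node.
  assert (Hx : 0 < INR (S n) * hh beta) by (apply Rmult_lt_0_compat; [apply lt_0_INR; lia|lra]).
  rewrite Csqrt_RtoC by lra. pose proof (sqrt_lt_R0 _ Hx).
  rewrite <- RtoC_minus, <- RtoC_mult, !Cexp_RtoC, RtoC_inv, Rmult_minus_distr_l by lra.
  unfold TT, Cdiv. ring.
Qed.

Section Poles.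
Variables (beta : R) (Nt : nat) (om : C).
Let T := TT beta Nt.
Hypothesis Hbeta : 0 <= beta < 2.
Hypothesis Harg : Rabs (Im om) <= beta * PI / 4.
Hypothesis Hmod : 2 + beta <= T + Re om.
Hypothesis Hle1 : Re om <= 0.

Let z := Cexp (2 * om).
Let x0 := 1 - beta / 2.
Let x1 := 4 * T ^ 2 + 1 - beta / 2.
Let a := 2 * PI * (T + Re om).

Definition pole_root (s : R) : C := (T + Re om, Im om + s * (PI / 2)).

(* The poles of [f] inside the contour are [pole 1] and [pole (-1)]. *)
Definition pole (s : R) : C := (pole_root s * pole_root s)%C.

Lemma Csqrt_pole (s : R) : Csqrt (pole s) = pole_root s.
Proof. apply Csqrt_sqr. simpl. lra. Qed.

Lemma Im_pole (s : R) : Im (pole s) = 2 * (T + Re om) * (Im om + s * (PI / 2)).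
Proof. simpl. ring. Qed.

Lemma Im_pole_root_bounds (s : R) : s = 1 \/ s = -1 ->
  PI * (2 - beta) / 4 <= s * (Im om + s * (PI / 2)) <= PI * (2 + beta) / 4.
Proof.
  intros Hs. apply Rabs_le_between in Harg. destruct Hs as [-> | ->]; lra.
Qed.

Lemma Cexp_double_pole (s : R) : s = 1 \/ s = -1 ->
  Cexp (2 * (pole_root s - RtoC T)) = (- z)%C.
Proof.
  intros Hs. replace (2 * (pole_root s - RtoC T))%C with (2 * om + Ci * RtoC (s * PI))%C
    by (unfold pole_root; destruct om; unfold Ci, Cminus, Cplus, Copp, Cmult, RtoC; simpl;
        f_equal; field).
  rewrite Cexp_plus, Cexp_Ci_mult_RtoC.
  replace ((cos (s * PI), sin (s * PI)) : C) with (- RtoC 1)%C; [unfold z; ring|].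
  unfold Copp, RtoC; simpl. destruct Hs as [-> | ->].
  - rewrite Rmult_1_l, cos_PI, sin_PI. f_equal; ring.
  - replace (-1 * PI) with (- PI) by ring. rewrite cos_neg, sin_neg, cos_PI, sin_PI. reflexivity.
Qed.

Lemma f_den_pole (s : R) : s = 1 \/ s = -1 -> f_den beta Nt z (pole s) = RtoC 0.
Proof.
  intros Hs. unfold f_den. fold T. rewrite Csqrt_pole, Cexp_double_pole by exact Hs. ring.
Qed.

Lemma Re_pole_bounds (s : R) : s = 1 \/ s = -1 -> x0 < Re (pole s) < x1.
Proof.
  intros Hs. destruct (Im_pole_root_bounds s Hs) as [Hq1 Hq2].
  pose proof PI_RGT_0. pose proof PI_lt_17_5. unfold x0, x1, pole, pole_root. simpl.
  set (q := Im om + s * (PI / 2)) in *. set (P := T + Re om) in *.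
  assert (Hqq : q * q <= 289 / 400 * ((2 + beta) * (2 + beta))).
  { replace (q * q) with ((s * q) * (s * q)) by (destruct Hs as [-> | ->]; ring).
    apply Rle_trans with (PI * (2 + beta) / 4 * (PI * (2 + beta) / 4)).
    - assert (0 <= PI * (2 - beta)) by (apply Rmult_le_pos; lra). apply Rmult_le_compat; lra.
    - replace (PI * (2 + beta) / 4 * (PI * (2 + beta) / 4))
        with (PI * PI / 16 * ((2 + beta) * (2 + beta))) by field.
      apply Rmult_le_compat_r; nra. }
  assert (HPT : P <= T) by (unfold P; lra).
  assert ((2 + beta) * (2 + beta) <= P * P) by (apply Rmult_le_compat; lra).
  assert (P * P <= T * T) by (apply Rmult_le_compat; lra).
  assert (0 <= q * q) by nra. split; nra.
Qed.

Lemma Im_pole_bounds (s : R) : s = 1 \/ s = -1 -> 0 < s * Im (pole s) < a.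
Proof.
  intros Hs. destruct (Im_pole_root_bounds s Hs) as [Hq1 Hq2]. rewrite Im_pole.
  pose proof PI_RGT_0. set (q := Im om + s * (PI / 2)) in *. unfold a.
  replace (s * (2 * (T + Re om) * q)) with (2 * (T + Re om) * (s * q)) by ring.
  assert (Hsq : 0 < s * q < PI)
    by (assert (0 < PI * (2 - beta)) by (apply Rmult_lt_0_compat; lra); lra).
  split; [apply Rmult_lt_0_compat; lra|].
  replace (2 * PI * (T + Re om)) with (2 * (T + Re om) * PI) by ring.
  apply Rmult_lt_compat_l; lra.
Qed.

Lemma f_den_eq_0 (u : C) : 0 < Re u -> Rabs (Im u) <= a -> f_den beta Nt z u = RtoC 0 ->
  u = pole 1 \/ u = pole (-1).
Proof.
  intros Hu Hi H. destruct (Cexp_double_plus_eq_0 _ _ H) as [k Hk]. fold T in Hk.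
  pose proof PI_RGT_0. apply Rabs_le_between in Harg.
  set (q := Im om + (IZR k * PI + PI / 2)).
  assert (Hroot : Csqrt u = (T + Re om, q)).
  { replace (Csqrt u) with (Csqrt u - RtoC T + RtoC T)%C by ring. rewrite Hk.
    unfold q. destruct om. unfold Cplus, RtoC; simpl. f_equal; ring. }
  assert (Hsqr : u = (((T + Re om)%R, q) * ((T + Re om)%R, q))%C)
    by (rewrite <- Hroot; symmetry; now apply Csqrt_mult_self).
  assert (Hq : - PI <= q <= PI).
  { apply Rabs_le_between. apply Rmult_le_reg_l with (2 * (T + Re om)); [lra|].
    rewrite <- (Rabs_pos_eq (2 * (T + Re om))) at 1 by (lra). rewrite <- Rabs_mult.
    replace (2 * (T + Re om) * q) with (Im u) by (rewrite Hsqr; simpl; ring).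
    unfold a in Hi. lra. }
  assert (Hk01 : (-2 < k < 1)%Z).
  { unfold q in Hq. split; apply lt_IZR; apply Rmult_lt_reg_r with PI; nra. }
  assert (Hk2 : (k = 0 \/ k = -1)%Z) by lia.
  rewrite Hsqr. unfold pole, pole_root.
  destruct Hk2 as [-> | ->]; [left|right]; unfold q;
    [replace (0 * PI + PI / 2) with (1 * (PI / 2)) by field
    |replace (-1 * PI + PI / 2) with (-1 * (PI / 2)) by field]; reflexivity.
Qed.

Definition f_residue (u : C) : C := (- (Cexp (Csqrt u - RtoC T) / RtoC PI))%C.

Lemma is_residue_f_uz (s : R) : s = 1 \/ s = -1 ->
  is_residue (fun u => f_uz beta Nt u z) (pole s) (f_residue (pole s)).
Proof.
  intros Hs. destruct (Re_pole_bounds s Hs) as [Hre _]. unfold x0 in Hre.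
  assert (Hpos : 0 < Re (pole s)) by lra.
  pose proof (Csqrt_neq_0 _ Hpos) as Hroot.
  pose proof RtoC_PI_neq_0 as HpiC.
  set (b := (Cexp (2 * (Csqrt (pole s) - RtoC T)) / Csqrt (pole s))%C).
  replace (f_residue (pole s)) with (f_num beta Nt z (pole s) / b)%C.
  - apply is_residue_div.
    + now apply ex_Cderive_continuous, ex_Cderive_f_num.
    + now apply is_Cderive_f_den.
    + now apply f_den_pole.
    + apply Cdiv_neq_0; [apply Cexp_neq_0|exact Hroot].
  - assert (Hz : z = (- Cexp (2 * (Csqrt (pole s) - RtoC T)))%C)
      by (rewrite Csqrt_pole, Cexp_double_pole by exact Hs; ring).
    unfold f_num, b, f_residue. fold T. rewrite Hz, Cexp_double.
    pose proof (Cexp_neq_0 (Csqrt (pole s) - RtoC T)). field. auto.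
Qed.

Lemma Cmod_f_residue_delta_le (s : R) : s = 1 \/ s = -1 ->
  Cmod (f_residue (pole s) * delta beta (pole s)) <= 2 / PI * exp (- T).
Proof.
  intros Hs. pose proof PI_RGT_0. pose proof (hh_pos beta (proj2 Hbeta)) as Hh.
  destruct (Im_pole_root_bounds s Hs) as [Hq _].
  assert (Hres : Cmod (f_residue (pole s)) = exp (Re om) / PI).
  { unfold f_residue. rewrite Csqrt_pole, Cmod_opp, Cmod_div, Cmod_Cexp, Cmod_R, Rabs_pos_eq
      by (lra || (apply RtoC_neq_0; lra)).
    f_equal. f_equal. simpl. ring. }
  assert (Hphase : T + Re om <= 2 * (PI * Rabs (Im (pole s)) / hh beta)).
  { apply Rmult_le_reg_r with (hh beta); [exact Hh|].
    replace (2 * (PI * Rabs (Im (pole s)) / hh beta) * hh beta)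
      with (2 * PI * Rabs (Im (pole s))) by (field; lra).
    apply Rle_trans with (2 * PI * (s * Im (pole s))).
    - rewrite Im_pole. set (q := Im om + s * (PI / 2)) in *.
      replace (2 * PI * (s * (2 * (T + Re om) * q))) with (4 * PI * (T + Re om) * (s * q)) by ring.
      apply Rle_trans with (4 * PI * (T + Re om) * (PI * (2 - beta) / 4)).
      + unfold hh. right. field.
      + apply Rmult_le_compat_l; [|exact Hq]. apply Rmult_le_pos; lra.
    - apply Rmult_le_compat_l; [lra|].
      destruct (proj1 (Rabs_le_between (Im (pole s)) _) (Rle_refl _)).
      destruct Hs as [-> | ->]; lra. }
  assert (Hdelta : Cmod (delta beta (pole s)) <= 2 * exp (- (T + Re om))).
  { eapply Rle_trans; [apply Cmod_delta_le; lra|]. apply Rmult_le_compat_l; [lra|].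
    apply exp_le. lra. }
  rewrite Cmod_mult, Hres.
  replace (2 / PI * exp (- T)) with (exp (Re om) / PI * (2 * exp (- (T + Re om)))).
  - apply Rmult_le_compat_l; [|exact Hdelta].
    left. apply Rdiv_lt_0_compat; [apply exp_pos|lra].
  - replace (- T) with (Re om + - (T + Re om)) by ring. rewrite exp_plus. field. lra.
Qed.

Lemma f_uz_delta_integral :
  rect_int (fun u => f_uz beta Nt u z * delta beta u)%C x0 x1 a
    = (seg_int (fun u => f_uz beta Nt u z) (RtoC x0) (RtoC x1) - r_t beta Nt z
       + 2 * RtoC PI * Ci * Clsum (fun p => f_residue p * delta beta p) [pole 1; pole (-1)])%C.
Proof.
  pose proof PI_RGT_0. pose proof (four_TT_sqr beta Nt (proj2 Hbeta)) as HT. fold T in HT.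
  destruct (Re_pole_bounds 1 (or_introl eq_refl)), (Re_pole_bounds (-1) (or_intror eq_refl)).
  destruct (Im_pole_bounds 1 (or_introl eq_refl)), (Im_pole_bounds (-1) (or_intror eq_refl)).
  assert (Hh : 1 - beta / 2 < hh beta).
  { unfold hh. pose proof PI2_3_2. assert (1 < PI ^ 2) by (simpl; nra). nra. }
  rewrite r_t_csum by apply Hbeta.
  apply (delta_contour_integral beta (fun u => f_uz beta Nt u z) f_residue x0 x1 a Nt
           [pole 1] [pole (-1)]).
  - apply Hbeta.
  - lra.
  - unfold x0. lra.
  - unfold x1. rewrite S_INR. lra.
  - lra.
  - constructor; [intros [E|[]]; rewrite E in *; lra|]. now repeat constructor.
  - intros u [Hux Huy] Hn. assert (Hu : 0 < Re u) by (unfold x0 in Hux; lra).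
    apply ex_Cderive_f_uz; [exact Hu|]. intros Hden. apply Hn.
    destruct (f_den_eq_0 u Hu) as [-> | ->]; simpl; auto. now apply Rabs_le.
  - intros p [<-|[]]. split; [unfold in_interior; lra|]. apply is_residue_f_uz. now left.
  - intros p [<-|[]]. split; [unfold in_interior; lra|]. apply is_residue_f_uz. now right.
Qed.

Lemma quadrature_error_bound :
  Cmod (seg_int (fun u => f_uz beta Nt u z) (RtoC x0) (RtoC x1) - r_t beta Nt z)
    <= Cmod (rect_int (fun u => f_uz beta Nt u z * delta beta u)%C x0 x1 a) + 8 * exp (- T).
Proof.
  rewrite f_uz_delta_integral. set (E := Clsum _ _).
  set (I := (seg_int _ _ _ - _)%C). pose proof PI_RGT_0.
  assert (HE : Cmod (2 * RtoC PI * Ci * E) <= 8 * exp (- T)).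
  { rewrite !Cmod_mult, Cmod_Ci, !Cmod_R, !Rabs_pos_eq by lra.
    apply Rle_trans with (2 * PI * 1 * (2 / PI * exp (- T) + 2 / PI * exp (- T))).
    - apply Rmult_le_compat_l; [lra|]. unfold E; simpl. rewrite Cplus_0_r.
      eapply Rle_trans; [apply Cmod_triangle|].
      apply Rplus_le_compat; apply Cmod_f_residue_delta_le; auto.
    - right. field. lra. }
  pose proof (Cmod_triangle_inv I (- (2 * RtoC PI * Ci * E))) as Ht. rewrite Cmod_opp in Ht.
  replace (I - - (2 * RtoC PI * Ci * E))%C with (I + 2 * RtoC PI * Ci * E)%C in Ht by ring. lra.
Qed.

End Poles.

(** * The truncated integral *)

Lemma Clog_lipschitz (p q : C) (m : R) : 0 < m -> m <= Re p -> m <= Re q ->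
  Cmod (Clog q - Clog p) <= Cmod (q - p) / m.
Proof.
  intros Hm Hp Hq.
  assert (Hseg : forall t, 0 <= t <= 1 -> m <= Re (seg_point p q t)).
  { intros t Ht. unfold seg_point. destruct p as [p1 p2], q as [q1 q2]. simpl in *. nra. }
  apply (is_seg_int_bound Cinv).
  - intros t Ht. specialize (Hseg t Ht). pose proof (re_le_Cmod (seg_point p q t)) as Hre.
    rewrite Rabs_pos_eq in Hre by lra.
    rewrite Cmod_inv by (apply Cmod_gt_0; lra). apply Rinv_le_contravar; lra.
  - apply is_seg_int_primitive; intros t Ht; specialize (Hseg t Ht).
    + apply is_Cderive_Clog. lra.
    + eapply is_Cderive_continuous, is_Cderive_inv. intros E. rewrite E in Hseg. simpl in Hseg. lra.
Qed.

(* This is [arctan (w / zeta)], with both logarithms taken in the right half plane. *)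
Definition Catan_ratio (zeta w : C) : C :=
  ((Clog (zeta + Ci * w) - Clog (zeta - Ci * w)) / (2 * Ci))%C.

Lemma is_Cderive_Catan_ratio (zeta w : C) :
  0 < Re (zeta + Ci * w) -> 0 < Re (zeta - Ci * w) ->
  is_Cderive (Catan_ratio zeta) w (zeta / (zeta * zeta + w * w)).
Proof.
  intros Hp Hm.
  assert (Hnz : forall u, 0 < Re u -> u <> RtoC 0) by (intros u Hu ->; simpl in Hu; lra).
  pose proof (Hnz _ Hp) as Hp0. pose proof (Hnz _ Hm) as Hm0.
  assert (Hprod : ((zeta + Ci * w) * (zeta - Ci * w))%C = (zeta * zeta + w * w)%C).
  { transitivity (zeta * zeta - Ci * Ci * (w * w))%C; [ring|rewrite Ci_sqr; ring]. }
  apply is_Cderive_ext with (fun v => / (2 * Ci) * (Clog (zeta + Ci * v) - Clog (zeta - Ci * v)))%C.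
  { intros v. unfold Catan_ratio, Cdiv. ring. }
  eapply is_Cderive_eq.
  - apply is_Cderive_scal, is_Cderive_minus; apply (is_Cderive_comp Clog);
      [now apply is_Cderive_Clog| |now apply is_Cderive_Clog|].
    + apply is_Cderive_plus; [apply is_Cderive_const|apply is_Cderive_scal, is_Cderive_id].
    + apply is_Cderive_minus; [apply is_Cderive_const|apply is_Cderive_scal, is_Cderive_id].
  - rewrite <- Hprod. field. repeat split; auto using Ci_nz, RtoC_2_neq_0.
Qed.

Lemma Re_plus_minus_Ci_RtoC (zeta : C) (w : R) :
  Re (zeta + Ci * RtoC w) = Re zeta /\ Re (zeta - Ci * RtoC w) = Re zeta.
Proof. destruct zeta; simpl; split; ring. Qed.

Lemma Cmod_div_2Ci (u : C) : Cmod (u / (2 * Ci)) = Cmod u / 2.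
Proof.
  rewrite Cmod_div by (apply Cmult_neq_0; auto using Ci_nz, RtoC_2_neq_0).
  rewrite Cmod_mult, Cmod_Ci, Cmod_R, Rabs_pos_eq by lra. now rewrite Rmult_1_r.
Qed.

Lemma Cmod_Catan_ratio_le (zeta : C) (w : R) : 0 < Re zeta -> 0 <= w ->
  Cmod (Catan_ratio zeta (RtoC w)) <= w / Re zeta.
Proof.
  intros Hz Hw. destruct (Re_plus_minus_Ci_RtoC zeta w) as [Hplus Hminus].
  unfold Catan_ratio. rewrite Cmod_div_2Ci.
  pose proof (Clog_lipschitz (zeta - Ci * RtoC w) (zeta + Ci * RtoC w) (Re zeta) Hz) as H.
  rewrite Hplus, Hminus in H. specialize (H (Rle_refl _) (Rle_refl _)).
  replace (zeta + Ci * RtoC w - (zeta - Ci * RtoC w))%C with (Ci * RtoC (2 * w))%C in H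
    by (rewrite RtoC_mult; ring).
  rewrite Cmod_mult, Cmod_Ci, Cmod_R, Rabs_pos_eq in H by lra.
  replace (w / Re zeta) with (1 * (2 * w) / Re zeta / 2) by (field; lra). lra.
Qed.

Lemma Cmod_Catan_ratio_minus_PI2_le (zeta : C) (w : R) : 0 < Re zeta -> 2 * Cmod zeta <= w ->
  Cmod (Catan_ratio zeta (RtoC w) - RtoC (PI / 2)) <= 2 * Cmod zeta / w.
Proof.
  intros Hz Hw. pose proof (re_le_Cmod zeta) as Hre. pose proof (im_le_Cmod zeta) as Him.
  apply Rabs_le_between in Him. rewrite Rabs_pos_eq in Hre by lra.
  assert (Hplus : Clog (zeta + Ci * RtoC w)
            = (Clog (RtoC w - Ci * zeta) + RtoC (PI / 2) * Ci)%C).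
  { rewrite Clog_rotate by (destruct zeta; simpl in *; lra). f_equal. f_equal.
    transitivity (- (Ci * Ci) * RtoC w - Ci * zeta)%C; [ring|rewrite Ci_sqr; ring]. }
  assert (Hminus : Clog (RtoC w + Ci * zeta)
            = (Clog (zeta - Ci * RtoC w) + RtoC (PI / 2) * Ci)%C).
  { rewrite Clog_rotate by (destruct zeta; simpl in *; lra). f_equal. f_equal.
    transitivity (- (Ci * Ci) * zeta - Ci * RtoC w)%C; [ring|rewrite Ci_sqr; ring]. }
  replace (Catan_ratio zeta (RtoC w) - RtoC (PI / 2))%C
    with ((Clog (RtoC w - Ci * zeta) - Clog (RtoC w + Ci * zeta)) / (2 * Ci))%C.
  - rewrite Cmod_div_2Ci.
    pose proof (Clog_lipschitz (RtoC w + Ci * zeta) (RtoC w - Ci * zeta) (w / 2)) as H.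
    replace (RtoC w - Ci * zeta - (RtoC w + Ci * zeta))%C with (- (2 * (Ci * zeta)))%C in H by ring.
    rewrite Cmod_opp, !Cmod_mult, Cmod_Ci, Cmod_R, Rabs_pos_eq in H by lra.
    specialize (H ltac:(lra) ltac:(destruct zeta; simpl in *; lra)
                  ltac:(destruct zeta; simpl in *; lra)).
    replace (2 * Cmod zeta / w) with (2 * (1 * Cmod zeta) / (w / 2) / 2) by (field; lra). lra.
  - unfold Catan_ratio. rewrite Hplus, Hminus. field. auto using Ci_nz, RtoC_2_neq_0.
Qed.

Lemma f_den_RtoC_neq_0 (beta : R) (Nt : nat) (zeta : C) (x : R) : 0 < Re zeta -> 0 < x ->
  f_den beta Nt (zeta * zeta) (RtoC x) <> RtoC 0.
Proof.
  intros Hz Hx. unfold f_den. rewrite Csqrt_RtoC, Cexp_double, <- RtoC_minus, Cexp_RtoC by lra.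
  set (w := exp (sqrt x - TT beta Nt)). destruct (Re_plus_minus_Ci_RtoC zeta w) as [Hplus Hminus].
  replace (RtoC w * RtoC w + zeta * zeta)%C
    with ((zeta + Ci * RtoC w) * (zeta - Ci * RtoC w))%C.
  - apply Cmult_neq_0; intros E; apply (f_equal Re) in E; simpl Re in E at 2; lra.
  - transitivity (zeta * zeta - Ci * Ci * (RtoC w * RtoC w))%C; [ring|rewrite Ci_sqr; ring].
Qed.

Lemma is_Cderive_f_uz_primitive (beta : R) (Nt : nat) (zeta : C) (x : R) :
  0 < Re zeta -> 0 < x ->
  is_Cderive (fun u => 2 * zeta / RtoC PI
                       * Catan_ratio zeta (Cexp (Csqrt u - RtoC (TT beta Nt))))%C
    (RtoC x) (f_uz beta Nt (RtoC x) (zeta * zeta)).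
Proof.
  intros Hz Hx. set (W := fun u => Cexp (Csqrt u - RtoC (TT beta Nt))).
  set (w := exp (sqrt x - TT beta Nt)).
  assert (HW : W (RtoC x) = RtoC w)
    by (unfold W; rewrite Csqrt_RtoC, <- RtoC_minus, Cexp_RtoC by lra; reflexivity).
  destruct (Re_plus_minus_Ci_RtoC zeta w) as [Hplus Hminus].
  pose proof (f_den_RtoC_neq_0 beta Nt zeta x Hz Hx) as Hden. unfold f_den in Hden.
  rewrite Cexp_double in Hden. fold (W (RtoC x)) in Hden.
  pose proof (Csqrt_neq_0 (RtoC x) Hx) as Hsqrt. pose proof PI_RGT_0.
  pose proof RtoC_PI_neq_0 as HpiC.
  eapply is_Cderive_eq.
  - apply is_Cderive_scal, (is_Cderive_comp (Catan_ratio zeta) W).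
    + apply is_Cderive_Catan_ratio; rewrite HW; lra.
    + apply (is_Cderive_comp Cexp); [apply is_Cderive_Cexp|].
      now apply is_Cderive_Csqrt_shift.
  - unfold f_uz. rewrite Cexp_double. fold (W (RtoC x)).
    field. auto.
Qed.

Lemma seg_int_f_uz (beta : R) (Nt : nat) (zeta : C) (x0 x1 : R) :
  0 < Re zeta -> 0 < x0 <= x1 ->
  seg_int (fun u => f_uz beta Nt u (zeta * zeta)) (RtoC x0) (RtoC x1)
    = (2 * zeta / RtoC PI
       * (Catan_ratio zeta (RtoC (exp (sqrt x1 - TT beta Nt)))
          - Catan_ratio zeta (RtoC (exp (sqrt x0 - TT beta Nt)))))%C.
Proof.
  intros Hz Hx.
  assert (Hseg : forall t, 0 <= t <= 1 ->
            exists x, seg_point (RtoC x0) (RtoC x1) t = RtoC x /\ 0 < x).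
  { intros t Ht. exists (x0 + t * (x1 - x0)). split; [apply seg_point_h|nra]. }
  set (G := fun u => (2 * zeta / RtoC PI
                      * Catan_ratio zeta (Cexp (Csqrt u - RtoC (TT beta Nt))))%C).
  transitivity (G (RtoC x1) - G (RtoC x0))%C.
  - apply is_seg_int_unique, is_seg_int_primitive; intros t Ht;
      destruct (Hseg t Ht) as [x [-> Hx0]].
    + now apply is_Cderive_f_uz_primitive.
    + apply ex_Cderive_continuous, ex_Cderive_f_uz; [exact Hx0|now apply f_den_RtoC_neq_0].
  - unfold G. rewrite !Csqrt_RtoC, <- !RtoC_minus, !Cexp_RtoC by lra. ring.
Qed.

Lemma seg_int_f_uz_bound (beta : R) (Nt : nat) (zeta : C) (x0 x1 : R) :
  let w x := exp (sqrt x - TT beta Nt) in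
  0 < Re zeta -> 0 < x0 <= x1 -> 2 * Cmod zeta <= w x1 ->
  Cmod (seg_int (fun u => f_uz beta Nt u (zeta * zeta)) (RtoC x0) (RtoC x1) - zeta)
    <= Cmod zeta * (2 * Cmod zeta / w x1 + w x0 / Re zeta).
Proof.
  intros w Hz Hx Hw1. rewrite seg_int_f_uz by auto. fold (w x0) (w x1).
  set (A1 := Catan_ratio zeta (RtoC (w x1))). set (A0 := Catan_ratio zeta (RtoC (w x0))).
  pose proof PI2_3_2 as Hpi. pose proof RtoC_PI_neq_0 as HpiC.
  replace (2 * zeta / RtoC PI * (A1 - A0) - zeta)%C
    with (RtoC (2 / PI) * (zeta * ((A1 - RtoC (PI / 2)) - A0)))%C
    by (rewrite !RtoC_div by lra; field; auto using RtoC_2_neq_0).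
  rewrite !Cmod_mult, Cmod_R.
  assert (H2pi : 0 < 2 / PI <= 1).
  { split; [apply Rdiv_lt_0_compat; lra|]. apply Rmult_le_reg_r with PI; [lra|].
    field_simplify; lra. }
  rewrite Rabs_pos_eq by lra.
  assert (HA : Cmod (A1 - RtoC (PI / 2) - A0) <= 2 * Cmod zeta / w x1 + w x0 / Re zeta).
  { eapply Rle_trans; [apply Cmod_triangle|]. rewrite Cmod_opp. apply Rplus_le_compat.
    - now apply Cmod_Catan_ratio_minus_PI2_le.
    - apply Cmod_Catan_ratio_le; [exact Hz|]. left. apply exp_pos. }
  rewrite <- (Rmult_1_l (Cmod zeta * (_ + _))).
  apply Rmult_le_compat; try lra.
  - apply Rmult_le_pos; apply Cmod_ge_0.
  - apply Rmult_le_compat_l; [apply Cmod_ge_0|exact HA].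
Qed.

(** * Points on the two rays *)

Definition ray_angle (beta : R) (s : bool) : R := (if s then 1 else -1) * beta * PI / 4.

Lemma ray_pt_angle (beta : R) (s : bool) (r : R) :
  ray_pt beta s r = (RtoC r * Cexp (0, (2 * ray_angle beta s)%R))%C.
Proof. unfold ray_pt, ray_angle. do 3 f_equal. field. Qed.

Lemma Rabs_ray_angle (beta : R) (s : bool) : 0 <= beta ->
  Rabs (ray_angle beta s) = beta * PI / 4.
Proof.
  intros Hb. pose proof PI_RGT_0. unfold ray_angle, Rabs.
  destruct s; destruct (Rcase_abs _); nra.
Qed.

Lemma cos_ray_angle (beta : R) (s : bool) : cos (ray_angle beta s) = cos (beta * PI / 4).
Proof.
  unfold ray_angle. destruct s; [f_equal; field|].
  rewrite <- cos_neg. f_equal. field.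
Qed.

Lemma cos_quarter_pos (beta : R) : 0 <= beta < 2 -> 0 < cos (beta * PI / 4).
Proof. intros Hb. pose proof PI_RGT_0. apply cos_gt_0; nra. Qed.

Lemma Cmod_ray_pt (beta : R) (s : bool) (r : R) : 0 <= r -> Cmod (ray_pt beta s r) = r.
Proof.
  intros Hr. unfold ray_pt. rewrite Cmod_mult, Cmod_R, Cmod_Cexp, Rabs_pos_eq by exact Hr.
  simpl. rewrite exp_0. ring.
Qed.

Definition ray_log (beta : R) (s : bool) (r : R) : C := (ln r / 2, ray_angle beta s).

Lemma ray_pt_Cexp (beta : R) (s : bool) (r : R) : 0 < r ->
  ray_pt beta s r = Cexp (2 * ray_log beta s r).
Proof.
  intros Hr. rewrite ray_pt_angle.
  replace (2 * ray_log beta s r)%C with (RtoC (ln r) + (0, (2 * ray_angle beta s)%R))%C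
    by (unfold ray_log, Cplus, Cmult, RtoC; simpl; f_equal; field).
  rewrite Cexp_plus, Cexp_RtoC, exp_ln by exact Hr. reflexivity.
Qed.

Lemma Re_Cexp_ray_log (beta : R) (s : bool) (r : R) :
  Re (Cexp (ray_log beta s r)) = exp (ln r / 2) * cos (beta * PI / 4).
Proof. simpl. now rewrite cos_ray_angle. Qed.

Lemma Csqrt_ray_pt (beta : R) (s : bool) (r : R) : 0 <= beta < 2 -> 0 < r ->
  Csqrt (ray_pt beta s r) = Cexp (ray_log beta s r).
Proof.
  intros Hb Hr. rewrite ray_pt_Cexp, Cexp_double by exact Hr. apply Csqrt_sqr.
  rewrite Re_Cexp_ray_log. apply Rmult_lt_0_compat; [apply exp_pos|now apply cos_quarter_pos].
Qed.

(* Rotating by half the argument moves both summands into a half plane. *)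
Lemma Cmod_RtoC_plus_polar (t r theta : R) : 0 <= t -> 0 <= r -> 0 <= cos theta ->
  cos theta * t <= Cmod (RtoC t + RtoC r * Cexp (0, (2 * theta)%R)).
Proof.
  intros Ht Hr Hcos. rewrite <- (Rmult_1_l (Cmod _)).
  set (rot := Cexp (0, - theta)).
  assert (Hrot : Cmod rot = 1) by (unfold rot; rewrite Cmod_Cexp; apply exp_0).
  rewrite <- Hrot, <- Cmod_mult, Cmult_plus_distr_l.
  replace (rot * (RtoC r * Cexp (0, (2 * theta)%R)))%C with (RtoC r * Cexp (0, theta))%C.
  - eapply Rle_trans; [|apply re_le_Cmod]. eapply Rle_trans; [|apply Rle_abs].
    unfold rot, Cexp; simpl. rewrite exp_0, cos_neg. nra.
  - replace ((0, theta) : C) with ((0, (- theta)%R) + (0, (2 * theta)%R))%C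
      by (unfold Cplus; simpl; f_equal; ring).
    rewrite Cexp_plus. unfold rot. ring.
Qed.

(** * Small arguments *)

Lemma Cmod_csum_telescope (F : nat -> C) (b : nat -> R) (n : nat) :
  (forall j, Cmod (F (S j)) <= b j - b (S j)) -> Cmod (csum F n) <= b O - b n.
Proof.
  intros H. induction n as [|n IH]; cbn [csum].
  - rewrite Cmod_0. lra.
  - eapply Rle_trans; [apply Cmod_triangle|]. specialize (H n). lra.
Qed.

(* The decreasing function [exp (- sqrt t) / sqrt t] is compared with its integral
   over the interval of length [h] to the left of [(j + 1) h]. *)
Lemma exp_sqrt_telescope (h : R) (j : nat) : 0 < h ->
  let x i := sqrt (INR i * h) in
  h * (exp (- x (S j)) / x (S j)) <= 2 * (exp (- x j) - exp (- x (S j))).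
Proof.
  intros Hh x. set (y := x (S j)). set (y0 := x j).
  pose proof (pos_INR j) as Hj.
  assert (Hy : 0 < y) by (apply sqrt_lt_R0; rewrite S_INR; nra).
  assert (Hy0 : 0 <= y0) by apply sqrt_pos.
  assert (Hyy : y * y - y0 * y0 = h).
  { unfold y, y0, x. rewrite !sqrt_sqrt by (try rewrite S_INR; nra). rewrite S_INR. ring. }
  assert (Hle : y0 <= y) by nra.
  assert (Hexp : exp (- y0) - exp (- y) >= exp (- y) * (y - y0)).
  { replace (- y0) with (- y + (y - y0)) by ring. rewrite exp_plus.
    pose proof (exp_ineq1_le (y - y0)). pose proof (exp_pos (- y)). nra. }
  apply Rle_trans with (2 * (exp (- y) * (y - y0))); [|lra].
  apply Rmult_le_reg_r with y; [exact Hy|]. pose proof (exp_pos (- y)).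
  replace (h * (exp (- y) / y) * y) with (exp (- y) * h) by (field; lra).
  replace (2 * (exp (- y) * (y - y0)) * y) with (exp (- y) * (2 * (y * y - y0 * y))) by ring.
  apply Rmult_le_compat_l; nra.
Qed.

Lemma r_t_term_bound (beta T x r : R) (s : bool) : 0 <= beta < 2 -> 0 <= r -> 0 < x ->
  Cmod (RtoC (/ x) * (RtoC (exp (x - T)) / (RtoC (exp (2 * x - 2 * T)) + ray_pt beta s r)))
    <= exp T / cos (beta * PI / 4) * (exp (- x) / x).
Proof.
  intros Hb Hr Hx. pose proof (cos_quarter_pos beta Hb) as Hk.
  set (kap := cos (beta * PI / 4)) in *.
  set (w := exp (2 * x - 2 * T)). assert (Hw : 0 < w) by apply exp_pos.
  assert (Hlow : kap * w <= Cmod (RtoC w + ray_pt beta s r)).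
  { rewrite ray_pt_angle. unfold kap. rewrite <- (cos_ray_angle beta s).
    apply Cmod_RtoC_plus_polar; rewrite ?cos_ray_angle; fold kap; lra. }
  assert (Hkw : 0 < kap * w) by (apply Rmult_lt_0_compat; lra).
  assert (Hinv : 0 < / x) by (apply Rinv_0_lt_compat, Hx).
  rewrite Cmod_mult, Cmod_div by (apply Cmod_gt_0; lra). rewrite !Cmod_R.
  rewrite (Rabs_pos_eq (/ x)), (Rabs_pos_eq (exp _)) by (lra || (left; apply exp_pos)).
  replace (exp T / kap * (exp (- x) / x)) with (/ x * (exp (x - T) / (kap * w))).
  - apply Rmult_le_compat_l; [lra|].
    apply Rmult_le_compat_l; [left; apply exp_pos|]. now apply Rinv_le_contravar.
  - replace (exp (x - T)) with (exp T * exp (- x) * w)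
      by (unfold w; rewrite <- !exp_plus; f_equal; ring).
    field. lra.
Qed.

Lemma r_t_bound (beta : R) (Nt : nat) (s : bool) (r : R) : 0 <= beta < 2 -> 0 <= r ->
  Cmod (r_t beta Nt (ray_pt beta s r))
    <= 2 * exp (TT beta Nt) / cos (beta * PI / 4) * r.
Proof.
  intros Hb Hr. pose proof (hh_pos beta (proj2 Hb)) as Hh.
  pose proof (cos_quarter_pos beta Hb) as Hk. pose proof PI2_3_2 as Hpi.
  pose proof (exp_pos (TT beta Nt)) as HeT.
  set (A := 2 * exp (TT beta Nt) / cos (beta * PI / 4)). set (h := hh beta) in *.
  assert (HA : 0 <= A) by (left; apply Rdiv_lt_0_compat; lra).
  set (b := fun j => A / h * exp (- sqrt (INR j * h))).
  unfold r_t. set (F := fun j : nat => _).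
  assert (HF : forall j, Cmod (F (S j)) <= b j - b (S j)).
  { intros j. pose proof (exp_sqrt_telescope h j Hh) as Htel. cbv zeta in Htel.
    unfold b. set (x := sqrt (INR (S j) * h)) in *.
    assert (Hx : 0 < x) by (apply sqrt_lt_R0, Rmult_lt_0_compat; [apply lt_0_INR; lia|exact Hh]).
    apply Rle_trans with (A / (2 * h) * (h * (exp (- x) / x))).
    - replace (A / (2 * h) * (h * (exp (- x) / x)))
        with (exp (TT beta Nt) / cos (beta * PI / 4) * (exp (- x) / x)) by (unfold A; field; lra).
      now apply r_t_term_bound.
    - rewrite <- Rmult_minus_distr_l. replace (A / h) with (A / (2 * h) * 2) by (field; lra).
      rewrite Rmult_assoc. apply Rmult_le_compat_l; [|exact Htel]. apply Rdiv_le_0_compat; lra. }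
  assert (Hsum : Cmod (csum F Nt) <= A / h).
  { eapply Rle_trans; [exact (Cmod_csum_telescope F b Nt HF)|].
    assert (0 <= A / h) by (apply Rdiv_le_0_compat; lra).
    unfold b. simpl INR. rewrite Rmult_0_l, sqrt_0, Ropp_0, exp_0.
    pose proof (exp_pos (- sqrt (INR Nt * h))). nra. }
  pose proof RtoC_PI_neq_0 as HpiC.
  rewrite Cmod_mult, Cmod_div, Cmod_mult, Cmod_ray_pt, !Cmod_R by assumption. fold h.
  rewrite (Rabs_pos_eq h), (Rabs_pos_eq PI) by lra.
  apply Rle_trans with (r * h / PI * (A / h)).
  - apply Rmult_le_compat_l; [|exact Hsum]. apply Rdiv_le_0_compat; nra.
  - replace (r * h / PI * (A / h)) with (A * r / PI) by (field; lra).
    apply Rle_div_l; [lra|]. assert (0 <= A * r) by (apply Rmult_le_pos; lra). nra.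
Qed.

Lemma Cmod_Csqrt_ray_pt (beta : R) (s : bool) (r : R) : 0 <= beta < 2 -> 0 <= r ->
  Cmod (Csqrt (ray_pt beta s r)) = sqrt r.
Proof.
  intros Hb [Hr|<-].
  - rewrite Csqrt_ray_pt, Cmod_Cexp by auto. simpl.
    symmetry. apply sqrt_lem_1; [lra|left; apply exp_pos|].
    rewrite <- exp_plus. replace (ln r / 2 + ln r / 2) with (ln r) by field. now apply exp_ln.
  - replace (ray_pt beta s 0) with (RtoC 0) by (unfold ray_pt; ring).
    now rewrite Csqrt_RtoC, sqrt_0, Cmod_0 by lra.
Qed.

Lemma sqrt_exp_double (x : R) : sqrt (exp (2 * x)) = exp x.
Proof.
  replace (2 * x) with (x + x) by ring. rewrite exp_plus. apply sqrt_square. left; apply exp_pos.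
Qed.

Definition approximation_error (beta : R) (Nt : nat) (s : bool) (r : R) : R :=
  Cmod (r_t beta Nt (ray_pt beta s r) - Csqrt (ray_pt beta s r)).

Lemma approximation_error_small (beta : R) (Nt : nat) (s : bool) (r : R) : 0 <= beta < 2 ->
  0 <= r <= exp (4 + 2 * beta - 2 * TT beta Nt) ->
  approximation_error beta Nt s r
    <= (2 * exp (4 + 2 * beta) / cos (beta * PI / 4) + exp (2 + beta)) * exp (- TT beta Nt).
Proof.
  intros Hb [Hr0 Hr1]. pose proof (cos_quarter_pos beta Hb) as Hk.
  set (T := TT beta Nt) in *. rewrite Rmult_plus_distr_r.
  eapply Rle_trans; [apply Cmod_triangle|]. rewrite Cmod_opp. apply Rplus_le_compat.
  - eapply Rle_trans; [now apply r_t_bound|]. fold T.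
    replace (2 * exp (4 + 2 * beta) / cos (beta * PI / 4) * exp (- T))
      with (2 * exp T / cos (beta * PI / 4) * exp (4 + 2 * beta - 2 * T)).
    + apply Rmult_le_compat_l; [|exact Hr1].
      left. apply Rdiv_lt_0_compat; [pose proof (exp_pos T)|]; lra.
    + replace (- T) with (T + - (2 * T)) by ring. unfold Rminus. rewrite !exp_plus. field. lra.
  - rewrite Cmod_Csqrt_ray_pt by auto. rewrite <- exp_plus, <- sqrt_exp_double.
    apply sqrt_le_1_alt. eapply Rle_trans; [exact Hr1|]. right. f_equal. ring.
Qed.

Lemma exp_sqrt_shift_le (x T : R) : 0 <= x <= 1 -> exp (sqrt x - T) <= 3 * exp (- T).
Proof.
  intros Hx. unfold Rminus. rewrite exp_plus.
  apply Rmult_le_compat_r; [left; apply exp_pos|].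
  apply Rle_trans with (exp 1); [|apply exp_le_3]. apply exp_le.
  rewrite <- sqrt_1. apply sqrt_le_1_alt. lra.
Qed.

Lemma truncation_error (beta : R) (Nt : nat) (s : bool) (r : R) :
  0 <= beta < 2 -> 0 < r <= 1 -> 1 <= TT beta Nt ->
  Cmod (seg_int (fun u => f_uz beta Nt u (ray_pt beta s r)) (RtoC (1 - beta / 2))
          (RtoC (4 * TT beta Nt ^ 2 + 1 - beta / 2)) - Csqrt (ray_pt beta s r))
    <= (2 + 3 / cos (beta * PI / 4)) * exp (- TT beta Nt).
Proof.
  intros Hb Hr HT. set (T := TT beta Nt) in *. pose proof (cos_quarter_pos beta Hb) as Hk.
  rewrite Csqrt_ray_pt, ray_pt_Cexp, Cexp_double by lra.
  pose proof (Re_Cexp_ray_log beta s r) as Hre. pose proof (Cmod_Cexp (ray_log beta s r)) as Hmod.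
  set (zeta := Cexp (ray_log beta s r)) in *. simpl (Re (ray_log _ _ _)) in Hmod.
  set (e := exp (ln r / 2)) in *. set (kap := cos (beta * PI / 4)) in *.
  assert (He0 : 0 < e) by apply exp_pos.
  assert (He1 : e <= 1).
  { unfold e. rewrite <- exp_0. apply exp_le.
    assert (ln r <= 0) by (rewrite <- ln_1; apply ln_le; lra). lra. }
  set (x0 := 1 - beta / 2). set (x1 := 4 * T ^ 2 + 1 - beta / 2).
  assert (Hw1 : exp T <= exp (sqrt x1 - T)).
  { apply exp_le. assert (2 * T <= sqrt x1); [|lra].
    rewrite <- (sqrt_Rsqr (2 * T)) by lra. apply sqrt_le_1_alt. unfold Rsqr, x1. simpl. lra. }
  pose proof (exp_ineq1_le T) as HeT. pose proof (exp_pos (- T)) as HeT'.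
  eapply Rle_trans.
  { apply (seg_int_f_uz_bound beta Nt zeta x0 x1); fold T.
    - rewrite Hre. apply Rmult_lt_0_compat; lra.
    - unfold x0, x1. simpl. nra.
    - lra. }
  fold T. rewrite Hmod, Hre, Rmult_plus_distr_l, Rmult_plus_distr_r. apply Rplus_le_compat.
  - set (w1 := exp (sqrt x1 - T)) in *.
    assert (Hinv : / w1 <= exp (- T))
      by (rewrite exp_Ropp; apply Rinv_le_contravar; [apply exp_pos|exact Hw1]).
    assert (0 < / w1) by (apply Rinv_0_lt_compat; lra).
    replace (e * (2 * e / w1)) with (2 * (e * e) * / w1) by (field; lra).
    apply Rmult_le_compat; nra.
  - replace (e * (exp (sqrt x0 - T) / (e * kap))) with (/ kap * exp (sqrt x0 - T)) by (field; lra).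
    replace (3 / kap * exp (- T)) with (/ kap * (3 * exp (- T))) by (field; lra).
    apply Rmult_le_compat_l; [left; apply Rinv_0_lt_compat, Hk|].
    apply exp_sqrt_shift_le. unfold x0. lra.
Qed.

Lemma approximation_error_large (beta : R) (Nt : nat) (s : bool) (r : R) : 0 <= beta < 2 ->
  exp (4 + 2 * beta - 2 * TT beta Nt) <= r <= 1 ->
  approximation_error beta Nt s r
    <= Cmod (Gamma_int beta Nt r (fun u => f_uz beta Nt u (ray_pt beta s r) * delta beta u)%C)
       + (10 + 3 / cos (beta * PI / 4)) * exp (- TT beta Nt).
Proof.
  intros Hb [Hr1 Hr2]. set (T := TT beta Nt) in *.
  assert (Hr0 : 0 < r) by (eapply Rlt_le_trans; [apply exp_pos|exact Hr1]).
  assert (Hln0 : ln r <= 0) by (rewrite <- ln_1; now apply ln_le).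
  assert (Hln1 : 4 + 2 * beta - 2 * T <= ln r).
  { rewrite <- (ln_exp (4 + 2 * beta - 2 * T)). apply ln_le; [apply exp_pos|exact Hr1]. }
  pose proof (truncation_error beta Nt s r Hb ltac:(lra) ltac:(fold T; lra)) as Htrunc.
  pose proof (quadrature_error_bound beta Nt (ray_log beta s r) Hb) as Hquad.
  rewrite <- ray_pt_Cexp in Hquad by exact Hr0.
  specialize (Hquad ltac:(simpl; rewrite Rabs_ray_angle; lra) ltac:(simpl; fold T; lra)
                ltac:(simpl; lra)).
  fold T in Htrunc, Hquad. unfold approximation_error.
  set (I := seg_int _ _ _) in *.
  replace (r_t beta Nt (ray_pt beta s r) - Csqrt (ray_pt beta s r))%C
    with (- (I - r_t beta Nt (ray_pt beta s r)) + (I - Csqrt (ray_pt beta s r)))%C by ring.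
  eapply Rle_trans; [apply Cmod_triangle|]. rewrite Cmod_opp.
  unfold Gamma_int. fold T. simpl (Re (ray_log _ _ _)) in Hquad. lra.
Qed.

Lemma TT_sqrt_eq (beta : R) (Nt : nat) : TT beta Nt = PI * sqrt ((2 - beta) * INR Nt / 4).
Proof.
  pose proof PI_RGT_0. unfold TT, hh.
  replace (INR Nt * ((2 - beta) * PI ^ 2) / 4)
    with ((PI * PI) * ((2 - beta) * INR Nt / 4)) by field.
  rewrite sqrt_mult_alt by nra. now rewrite sqrt_square by lra.
Qed.

Theorem theorem5p1 (beta : R) (Hbeta : 0 <= beta < 2) :
  (exists K : R, exists N0 : nat, forall Nt : nat, (N0 <= Nt)%nat ->
     forall (s : bool) (r : R),
       exp (4 + 2 * beta - 2 * TT beta Nt) <= r <= 1 ->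
       Cmod (Gamma_int beta Nt r
               (fun u => (f_uz beta Nt u (ray_pt beta s r) * delta beta u)%C))
         <= K * exp (- TT beta Nt)) ->
  exists C0 : R, exists N1 : nat, forall Nt : nat, (N1 <= Nt)%nat ->
    forall (s : bool) (r : R), 0 <= r <= 1 ->
      Cmod (r_t beta Nt (ray_pt beta s r) - Csqrt (ray_pt beta s r))%C
        <= C0 * exp (- sqrt (INR Nt * hh beta / 4)) /\
      Cmod (r_t beta Nt (ray_pt beta s r) - Csqrt (ray_pt beta s r))%C
        <= C0 * exp (- (PI * sqrt ((2 - beta) * INR Nt / 4))).
Proof.
  intros [K [N0 HK]]. set (kap := cos (beta * PI / 4)).
  exists (Rmax (K + (10 + 3 / kap)) (2 * exp (4 + 2 * beta) / kap + exp (2 + beta))), N0.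
  intros Nt HNt s r Hr. rewrite <- TT_sqrt_eq. fold (TT beta Nt) (approximation_error beta Nt s r).
  pose proof (exp_pos (- TT beta Nt)) as Hpos.
  enough (Hbound : approximation_error beta Nt s r <= _) by (split; exact Hbound).
  destruct (Rle_lt_dec (exp (4 + 2 * beta - 2 * TT beta Nt)) r) as [Hlarge|Hsmall].
  - eapply Rle_trans; [|apply Rmult_le_compat_r; [lra|apply Rmax_l]].
    rewrite Rmult_plus_distr_r.
    eapply Rle_trans; [apply approximation_error_large; [exact Hbeta|lra]|].
    apply Rplus_le_compat_r, HK; [exact HNt|lra].
  - eapply Rle_trans; [|apply Rmult_le_compat_r; [lra|apply Rmax_r]].
    apply approximation_error_small; [exact Hbeta|lra].
Qed.
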